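(* Let $F$ be a $\theta$-field with field of constants $K$ (setting as in the context) and let $R$ be a PPV-ring over $F$. Then the group functor $\underline{\mathrm{Aut}}^\theta(R/F)$ from $K$-algebras to groups, $L\mapsto\mathrm{Aut}^\theta(R_L/F_L)$, is represented by the finitely generated $K$-algebra $U=C_{R\otimes_FR}$ (the ring of constants of $R\otimes_FR$); i.e. $\underline{\mathrm{Aut}}^\theta(R/F)$ is an affine group scheme of finite type over $K$.
   Context: Cgas and higher derivations. For a commutative ring $S$, an $S$-cga is the completion $B$ of a graded commutative $S$-algebra $\bigoplus_{i\ge0}B_i$ with $B_0=S$, with respect to the filtration by the ideals $\bigoplus_{i\ge k}B_i$ (so $B=\prod_iB_i$). For an $S$-algebra $S'$, $S'\otimes B$ denotes the $S'$-cga with homogeneous components $S'\otimes_SB_k$. A continuous additive map $g:B\to B$ is positive if it never lowers degree; $g^{(i)}$ is its part raising degree by $i$. Let $K$ be a field. A higher derivation over $K$ of a $K$-algebra $S$ into an $S$-cga $B$ is a $K$-algebra homomorphism $\theta:S\to B$ whose degree-$0$ component is $\mathrm{id}_S$; $\theta^{(k)}:S\to B_k$ is its degree-$k$ component. It is iterable if (1) the graded $S$-algebra $\bigoplus_kB_k$ is generated by the elements $\theta^{(k)}(r)$, $k\ge0$, $r\in S$; and (2) $\theta$ extends to a positive continuous $K$-algebra endomorphism $\theta_B$ of $B$ with $\theta_B^{(i)}\circ\theta_B^{(j)}=\binom{i+j}{i}\theta_B^{(i+j)}$ for all $i,j\ge0$. Setting. $K$ is a field, $F$ a field containing $K$, $\tilde\Omega$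 an $F$-cga without zero divisors, $\theta:F\to\tilde\Omega$ an iterable higher derivation over $K$ with $K=\{t\in F\mid\theta(t)=t\}$. $\theta$-rings. A $\theta$-ring is a (commutative) $F$-algebra $R$ with an iterable higher derivation $\theta_R:R\to R\otimes\tilde\Omega$ extending $\theta$. Its ring of constants is $C_R=\{r\mid\theta_R(r)=r\otimes1\}$. An ideal $I$ is a $\theta$-ideal if $\theta_R^{(k)}(I)\subseteq I\otimes_F\tilde\Omega_k$ for all $k$; $R$ is $\theta$-simple if it has no proper nontrivial $\theta$-ideals. $R\otimes_F\tilde R$ is a $\theta$-ring via $\theta^{(k)}(r\otimes\tilde r)=\sum_{i+j=k}\theta_R^{(i)}(r)\theta_{\tilde R}^{(j)}(\tilde r)$. For a $K$-algebra $L$, put $R_L=R\otimes_KL$, $F_L=F\otimes_KL$, with $\theta$ extended trivially: $\theta(r\otimes a)=\theta_R(r)\otimes a$. $\mathrm{Aut}^\theta(R_L/F_L)$ is the group of $F_L$-linear ring automorphisms of $R_L$ commuting with $\theta$. PPV-rings. An iterable higher differential equation over $F$ is an equation $\theta(y)=Ay$ with $A=\sum_kA_k\in\mathrm{GL}_n(\tilde\Omega)$, $A_k\in\mathrm{Mat}_n(\tilde\Omega_k)$, $A_0=1_n$, and $\binom{k+l}{l}A_{k+l}=\sum_{i+j=l}\theta_{\tilde\Omega}^{(i)}(A_k)A_j$ for all $k,l\ge0$. A $\theta$-ring $R$ is a PPV-ring over $F$ for this equation if: $R$ is $\theta$-simple; there is $Y\in\mathrm{GL}_n(R)$ with $\theta_R(Y)=AY$;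 $R$ is generated as an $F$-algebra by the entries of $Y$ and $\det(Y)^{-1}$; and $C_R=C_F=K$. ''PPV-ring over $F$'' means PPV-ring for some such equation. *)

(* Defs.v *)
From HB Require Import structures.
From mathcomp Require Import all_boot all_order all_algebra.
From mathcomp Require Import boolp.

Set Implicit Arguments.
Unset Strict Implicit.
Unset Printing Implicit Defensive.

Import GRing.Theory.
Local Open Scope ring_scope.
Local Open Scope quotient_scope.

(* algType is restricted to non-zero rings; commutative algebras are encoded by
   their structure morphism instead, so that the zero algebra is allowed. *)
Record calg (S : comPzRingType) := CAlg {
  calg_sort :> comPzRingType;
  calg_in : {rmorphism S -> calg_sort} }.
Arguments calg_in {S} c.

Record ahom (S : comPzRingType) (A B : calg S) := AHom {
  ahom_fun :> {rmorphism A -> B};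
  ahomP : forall s, ahom_fun (calg_in A s) = calg_in B s }.

Definition subalg (S : comPzRingType) (A : calg S) (P : A -> Prop) :=
  [/\ forall s, P (calg_in A s),
      forall x y, P x -> P y -> P (x + y)
    & forall x y, P x -> P y -> P (x * y)].

Definition generates (S : comPzRingType) (A : calg S) (G : A -> Prop) :=
  forall P : A -> Prop, subalg P -> (forall x, G x -> P x) -> forall x, P x.

Definition fin_gen (S : comPzRingType) (A : calg S) :=
  exists s : seq A, generates (fun x => x \in s).

Section Tensor.
Variables (S : comPzRingType) (A B : calg S).

(* A formal sum of pairs is a sequence; the relation presents A (x)_S B as the
   free commutative monoid on A * B modulo biadditivity and S-balancedness. *)
Inductive tens_rel : seq (A * B) -> seq (A * B) -> Prop :=
| TRefl s : tens_rel s s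
| TSym s t : tens_rel s t -> tens_rel t s
| TTrans s t u : tens_rel s t -> tens_rel t u -> tens_rel s u
| TCat s s' t t' : tens_rel s s' -> tens_rel t t' -> tens_rel (s ++ t) (s' ++ t')
| TSwap s t : tens_rel (s ++ t) (t ++ s)
| TZero b : tens_rel [:: (0, b)] [::]
| TAddl a a' b : tens_rel [:: (a + a', b)] [:: (a, b); (a', b)]
| TAddr a b b' : tens_rel [:: (a, b + b')] [:: (a, b); (a, b')]
| TBal s a b : tens_rel [:: (calg_in A s * a, b)] [:: (a, calg_in B s * b)].

Definition tens_relb s t := `[< tens_rel s t >].

Lemma tens_relb_refl : reflexive tens_relb.
Proof. by move=> s; apply/asboolP; constructor. Qed.
Lemma tens_relb_sym : symmetric tens_relb.
Proof. by move=> s t; apply/asboolP/asboolP; apply: TSym. Qed.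
Lemma tens_relb_trans : transitive tens_relb.
Proof.
by move=> t s u /asboolP h1 /asboolP h2; apply/asboolP; apply: TTrans h1 h2.
Qed.

Canonical tens_equiv := EquivRel tens_relb tens_relb_refl tens_relb_sym tens_relb_trans.

Definition tens := {eq_quot tens_equiv}.
HB.instance Definition _ := Choice.on tens.

Definition tpi (s : seq (A * B)) : tens := \pi_tens s.
Definition pure (a : A) (b : B) : tens := tpi [:: (a, b)].

Lemma tpiP s t : tens_rel s t <-> tpi s = tpi t.
Proof.
split; first by move=> /asboolP h; apply/eqquotP.
by move/eqquotP => /asboolP.
Qed.

Lemma tens_rel_repr s : tens_rel (repr (tpi s)) s.
Proof. by apply/tpiP; rewrite /tpi reprK. Qed.

Definition tadd (x y : tens) : tens := tpi (repr x ++ repr y).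
Definition topp (x : tens) : tens := tpi [seq (- p.1, p.2) | p <- repr x].

Lemma tadd_pi s t : tadd (tpi s) (tpi t) = tpi (s ++ t).
Proof. by apply/tpiP; apply: TCat; apply: tens_rel_repr. Qed.

Lemma taddC : commutative tadd.
Proof. by move=> x y; apply/tpiP/TSwap. Qed.
Lemma taddA : associative tadd.
Proof.
elim/quotW => s; elim/quotW => t; elim/quotW => u.
by rewrite -!/(tpi _) !tadd_pi catA.
Qed.
Lemma tadd0 : left_id (tpi [::]) tadd.
Proof. by elim/quotW => s; rewrite -!/(tpi _) tadd_pi. Qed.

Lemma tens_rel_opp s t : tens_rel s t ->
  tens_rel [seq (- p.1, p.2) | p <- s] [seq (- p.1, p.2) | p <- t].
Proof.
elim=> {s t} /=.
- by move=> s; constructor.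
- by move=> s t _; apply: TSym.
- by move=> s t u _ h1 _; apply: TTrans h1.
- by move=> s s' t t' _ h1 _ h2; rewrite !map_cat; apply: TCat.
- by move=> s t; rewrite !map_cat; apply: TSwap.
- by move=> b; rewrite oppr0; constructor.
- by move=> a a' b; rewrite opprD; constructor.
- by move=> a b b'; constructor.
- by move=> s a b; rewrite -mulrN; constructor.
Qed.

Lemma topp_pi s : topp (tpi s) = tpi [seq (- p.1, p.2) | p <- s].
Proof. by apply/tpiP/tens_rel_opp/tens_rel_repr. Qed.

Lemma taddN : left_inverse (tpi [::]) topp tadd.
Proof.
elim/quotW => s; rewrite -!/(tpi _) topp_pi tadd_pi; apply/tpiP.
elim: s => [|[a b] s IHs] /=; first by constructor.
rewrite -cat1s -[_ :: s]cat1s catA.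
set u := map _ s in IHs *.
apply: (@TTrans _ (([:: (- a, b)] ++ [:: (a, b)]) ++ (u ++ s))).
  by rewrite !catA; apply: TCat (TRefl _); rewrite -!catA; apply: TCat (TRefl _) _; apply: TSwap.
rewrite -[[::]]/([::] ++ [::]); apply: TCat IHs.
apply: TTrans (TSym (TAddl _ _ _)) _.
by rewrite addNr; constructor.
Qed.

HB.instance Definition _ := GRing.isZmodule.Build tens taddA taddC tadd0 taddN.

Lemma tpi_cat s t : tpi (s ++ t) = tpi s + tpi t.
Proof. by rewrite -tadd_pi. Qed.

Lemma tpiE s : tpi s = \sum_(p <- s) pure p.1 p.2.
Proof.
elim: s => [|[a b] s IHs]; first by rewrite big_nil.
by rewrite big_cons -IHs -cat1s tpi_cat.
Qed.

Lemma tensE (x : tens) : x = \sum_(p <- repr x) pure p.1 p.2.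
Proof. by rewrite -tpiE /tpi reprK. Qed.

Lemma pureDl a a' b : pure (a + a') b = pure a b + pure a' b.
Proof. by rewrite -tpi_cat; apply/tpiP; constructor. Qed.
Lemma pureDr a b b' : pure a (b + b') = pure a b + pure a b'.
Proof. by rewrite -tpi_cat; apply/tpiP; constructor. Qed.
Lemma pure_bal s a b : pure (calg_in A s * a) b = pure a (calg_in B s * b).
Proof. by apply/tpiP; constructor. Qed.
Lemma pure0l b : pure 0 b = 0.
Proof. by apply/tpiP; constructor. Qed.
Lemma pure0r a : pure a 0 = 0.
Proof. by rewrite -(mul0r 0) -(rmorph0 (calg_in B)) -pure_bal rmorph0 mul0r pure0l. Qed.

Lemma tens_ind (P : tens -> Prop) :
  P 0 -> (forall x y, P x -> P y -> P (x + y)) -> (forall a b, P (pure a b)) ->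
  forall x, P x.
Proof.
move=> P0 PD Pp x; rewrite (tensE x).
by elim: (repr x) => [|p s IHs]; rewrite ?big_nil // big_cons; apply: PD.
Qed.

Lemma tens_ext (Z : zmodType) (f g : {additive tens -> Z}) :
  (forall a b, f (pure a b) = g (pure a b)) -> f =1 g.
Proof.
move=> fg; elim/tens_ind => [|x y hx hy|//]; first by rewrite !raddf0.
by rewrite !raddfD hx hy.
Qed.

Definition balanced (Z : zmodType) (f : A -> B -> Z) :=
  [/\ forall a a' b, f (a + a') b = f a b + f a' b,
      forall a b b', f a (b + b') = f a b + f a b'
    & forall s a b, f (calg_in A s * a) b = f a (calg_in B s * b)].

(* tlift f is the additive map sending a (x) b to f a b when f is balanced, and
   is only meaningful in that case. *)
Definition tlift (Z : zmodType) (f : A -> B -> Z) (x : tens) : Z :=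
  \sum_(p <- repr x) f p.1 p.2.

Section Lift.
Variables (Z : zmodType) (f : A -> B -> Z) (fP : balanced f).

Lemma bal0l b : f 0 b = 0.
Proof. by case: fP => h _ _; apply: (addIr (f 0 b)); rewrite -h !add0r. Qed.

Lemma tlift_pi s : tlift f (tpi s) = \sum_(p <- s) f p.1 p.2.
Proof.
rewrite /tlift; have := tens_rel_repr s; move: (repr _) => t; case: (fP) => fl fr fb.
elim=> {s t} //.
- by move=> s t u _ -> _ ->.
- by move=> s s' t t' _ h1 _ h2; rewrite !big_cat /= h1 h2.
- by move=> s t; rewrite !big_cat /= addrC.
- by move=> b; rewrite big_seq1 big_nil bal0l.
- by move=> a a' b; rewrite !big_cons !big_nil !addr0 fl.
- by move=> a b b'; rewrite !big_cons !big_nil !addr0 fr.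
- by move=> s a b; rewrite !big_cons !big_nil !addr0 fb.
Qed.

Lemma tlift_pure a b : tlift f (pure a b) = f a b.
Proof. by rewrite tlift_pi big_seq1. Qed.

Lemma tliftD : {morph tlift f : x y / x + y}.
Proof.
elim/quotW => s; elim/quotW => t.
by rewrite -!/(tpi _) -tpi_cat !tlift_pi big_cat.
Qed.

Lemma tlift_zmod : zmod_morphism (tlift f).
Proof.
have h0 : tlift f 0 = 0 by apply: (addIr (tlift f 0)); rewrite -tliftD !add0r.
move=> x y; rewrite tliftD; congr (_ + _).
by apply: (addIr (tlift f y)); rewrite -tliftD !addNr.
Qed.
End Lift.

Definition tmul (x y : tens) : tens :=
  tlift (fun a b => tlift (fun a' b' => pure (a * a') (b * b')) y) x.

Lemma tmul_bal1 a b : balanced (fun a' b' => pure (a * a') (b * b')).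
Proof.
split=> *; rewrite ?mulrDr ?pureDl ?pureDr //.
by rewrite mulrCA pure_bal mulrCA.
Qed.

Lemma tmul_bal2 y : balanced (fun a b => tlift (fun a' b' => pure (a * a') (b * b')) y).
Proof.
split=> *; rewrite /tlift -?big_split /=; apply: eq_bigr => p _.
- by rewrite mulrDl pureDl.
- by rewrite mulrDl pureDr.
- by rewrite -!mulrA pure_bal.
Qed.

Lemma tmul_pure a b a' b' : tmul (pure a b) (pure a' b') = pure (a * a') (b * b').
Proof.
by rewrite /tmul tlift_pure ?tlift_pure //; [exact: tmul_bal1|exact: tmul_bal2].
Qed.

Lemma tmulDl : left_distributive tmul +%R.
Proof. by move=> x y z; apply: tliftD (tmul_bal2 z) _ _. Qed.

Lemma tmulC : commutative tmul.
Proof.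
move=> x y; rewrite /tmul /tlift exchange_big /=.
apply: eq_bigr => p _; apply: eq_bigr => q _.
by rewrite mulrC [_ * p.2]mulrC.
Qed.

Lemma tmulDr : right_distributive tmul +%R.
Proof. by move=> x y z; rewrite !(tmulC x) tmulDl. Qed.

Lemma tmul0l x : tmul 0 x = 0.
Proof. by apply: (addIr (tmul 0 x)); rewrite -tmulDl !add0r. Qed.

Lemma tmul1 : left_id (pure 1 1) tmul.
Proof.
elim/tens_ind=> [|x y hx hy|a b].
- by rewrite tmulC tmul0l.
- by rewrite tmulDr hx hy.
- by rewrite tmul_pure !mul1r.
Qed.

Lemma tmulA : associative tmul.
Proof.
move=> x y z; move: x; elim/tens_ind=> [|x x' hx hy|a b].
- by rewrite !tmul0l.
- by rewrite !tmulDl hx hy.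
move: y; elim/tens_ind=> [|x x' hx hy|a' b'].
- by rewrite !(tmulC (pure a b)) !tmul0l.
- by rewrite tmulDl !(tmulDr (pure a b)) tmulDl hx hy.
move: z; elim/tens_ind=> [|x x' hx hy|a'' b''].
- by rewrite !(tmulC _ 0) !tmul0l (tmulC _ 0) tmul0l.
- by rewrite !tmulDr hx hy.
by rewrite !tmul_pure !mulrA.
Qed.

HB.instance Definition _ :=
  GRing.Zmodule_isComPzRing.Build tens tmulA tmulC tmul1 tmulDl.

Lemma pureM a b a' b' : pure a b * pure a' b' = pure (a * a') (b * b').
Proof. exact: tmul_pure. Qed.

Definition tinl (a : A) : tens := pure a 1.
Definition tinr (b : B) : tens := pure 1 b.

Lemma pureE a b : pure a b = tinl a * tinr b.
Proof. by rewrite pureM mulr1 mul1r. Qed.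

Lemma tinl_zmod : zmod_morphism tinl.
Proof.
move=> a a'; apply: (addIr (tinl a')).
by rewrite subrK -pureDl subrK.
Qed.
Lemma tinl_monoid : monoid_morphism tinl.
Proof. by split=> // a a'; rewrite pureM mulr1. Qed.
HB.instance Definition _ := GRing.isZmodMorphism.Build _ _ tinl tinl_zmod.
HB.instance Definition _ := GRing.isMonoidMorphism.Build _ _ tinl tinl_monoid.

Lemma tinr_zmod : zmod_morphism tinr.
Proof.
move=> a a'; apply: (addIr (tinr a')).
by rewrite subrK -pureDr subrK.
Qed.
Lemma tinr_monoid : monoid_morphism tinr.
Proof. by split=> // a a'; rewrite pureM mulr1. Qed.
HB.instance Definition _ := GRing.isZmodMorphism.Build _ _ tinr tinr_zmod.
HB.instance Definition _ := GRing.isMonoidMorphism.Build _ _ tinr tinr_monoid.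

Lemma tin_bal s : tinl (calg_in A s) = tinr (calg_in B s).
Proof. by rewrite /tinl /tinr -[calg_in A s]mulr1 pure_bal mulr1. Qed.

Section Pushout.
Variables (C : comPzRingType) (u : {rmorphism A -> C}) (v : {rmorphism B -> C}).
Hypothesis uv : forall s, u (calg_in A s) = v (calg_in B s).

Lemma tpush_bal : balanced (fun a b => u a * v b).
Proof.
split=> *; rewrite ?rmorphD ?mulrDl ?mulrDr // !rmorphM uv.
by rewrite -mulrA mulrCA.
Qed.

Definition tpush of (forall s, u (calg_in A s) = v (calg_in B s)) : tens -> C :=
  tlift (fun a b => u a * v b).
Local Notation w := (tpush uv).

Lemma tpush_pure a b : w (pure a b) = u a * v b.
Proof. exact: tlift_pure tpush_bal _ _. Qed.

Lemma tpush_zmod : zmod_morphism w.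
Proof. exact: tlift_zmod tpush_bal. Qed.
HB.instance Definition _ := GRing.isZmodMorphism.Build _ _ w tpush_zmod.

Lemma tpush_monoid : monoid_morphism w.
Proof.
split=> [|x y]; first by rewrite tpush_pure !rmorph1 mulr1.
move: x; elim/tens_ind=> [|x x' hx hy|a b].
- by rewrite mul0r !raddf0 mul0r.
- by rewrite mulrDl !raddfD /= mulrDl hx hy.
move: y; elim/tens_ind=> [|x x' hx hy|a' b'].
- by rewrite mulr0 !raddf0 mulr0.
- by rewrite mulrDr !raddfD /= mulrDr hx hy.
by rewrite pureM !tpush_pure !rmorphM mulrACA.
Qed.
HB.instance Definition _ := GRing.isMonoidMorphism.Build _ _ w tpush_monoid.

Lemma tpush_inl a : w (tinl a) = u a.
Proof. by rewrite tpush_pure rmorph1 mulr1. Qed.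
Lemma tpush_inr b : w (tinr b) = v b.
Proof. by rewrite tpush_pure rmorph1 mul1r. Qed.
End Pushout.

Lemma tens_rext (C : comPzRingType) (f g : {rmorphism tens -> C}) :
  (forall a, f (tinl a) = g (tinl a)) -> (forall b, f (tinr b) = g (tinr b)) ->
  f =1 g.
Proof. by move=> h1 h2; apply: tens_ext => a b /=; rewrite pureE !rmorphM /= h1 h2. Qed.

End Tensor.

(* The S-algebra A = (+)_k A_k is encoded by the projections gproj k onto its
   homogeneous components A_k = {x | gproj k x = x}; gaug is the identification
   of A_0 with S. *)
Record galg (S : comPzRingType) := GAlg {
  galg_alg :> calg S;
  gproj : nat -> galg_alg -> galg_alg;
  gaug : galg_alg -> S;
  gproj_zmod : forall k, zmod_morphism (gproj k);
  gprojZ : forall k s x, gproj k (calg_in galg_alg s * x) = calg_in galg_alg s * gproj k x;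
  gproj_proj : forall k l x, gproj k (gproj l x) = if k == l then gproj l x else 0;
  gproj_sum : forall x, exists n, x = \sum_(k < n) gproj k x;
  gprojM : forall k l x y, gproj (k + l) (gproj k x * gproj l y) = gproj k x * gproj l y;
  gproj0 : forall x, gproj 0 x = calg_in galg_alg (gaug x);
  gaugK : forall s, gaug (calg_in galg_alg s) = s }.
Arguments gproj {S g}.
Arguments gaug {S g}.

HB.instance Definition _ (S : comPzRingType) (A : galg S) k :=
  GRing.isZmodMorphism.Build A A (gproj k) (gproj_zmod k).

Lemma gproj_in (S : comPzRingType) (A : galg S) k s :
  gproj k (calg_in A s) = if k == 0%N then calg_in A s else 0.
Proof.
have <-: gproj 0 (calg_in A s) = calg_in A s by rewrite gproj0 gaugK.
by rewrite gproj_proj.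
Qed.

Section BaseChange.
Variables (S : comPzRingType) (T : calg S) (A : galg S).

Definition bc_alg : calg T := CAlg (@tinl _ T A).
Definition bc_proj k : bc_alg -> bc_alg := tlift (fun a x => pure a (gproj k x)).
Definition bc_aug : bc_alg -> T := tlift (fun a x => a * calg_in T (gaug x)).

Lemma bc_proj_bal k : @balanced _ T A _ (fun a x => pure a (gproj k x)).
Proof.
split=> *; rewrite ?pureDl //; first by rewrite raddfD pureDr.
by rewrite gprojZ pure_bal.
Qed.
Lemma bc_proj_pure k a x : bc_proj k (pure a x) = pure a (gproj k x).
Proof. exact: tlift_pure (bc_proj_bal k) _ _. Qed.

Lemma gaug_zmod : zmod_morphism (@gaug S A).
Proof.
have inj : injective (calg_in A) by move=> s t h; rewrite -(gaugK A s) h gaugK.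
by move=> x y; apply: inj; rewrite rmorphB -!gproj0 raddfB.
Qed.

Lemma gaugZ s (x : A) : gaug (calg_in A s * x) = s * gaug x.
Proof.
have inj : injective (calg_in A) by move=> u t h; rewrite -(gaugK A u) h gaugK.
by apply: inj; rewrite rmorphM -!gproj0 gprojZ.
Qed.

Lemma bc_aug_bal : @balanced _ T A _ (fun a x => a * calg_in T (gaug x)).
Proof.
split=> [*|a x y|s a x]; first by rewrite mulrDl.
  have <- : gaug (x - (- y)) = gaug (x + y) by rewrite opprK.
  by rewrite !gaug_zmod -[- y]sub0r gaug_zmod -(subrr 0) gaug_zmod subrr sub0r opprK rmorphD mulrDr.
by rewrite gaugZ rmorphM mulrCA mulrA.
Qed.
Lemma bc_aug_pure a x : bc_aug (pure a x) = a * calg_in T (gaug x).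
Proof. exact: tlift_pure bc_aug_bal _ _. Qed.

Lemma bc_proj_zmod k : zmod_morphism (bc_proj k).
Proof. exact: tlift_zmod (bc_proj_bal k). Qed.
HB.instance Definition _ k :=
  GRing.isZmodMorphism.Build bc_alg bc_alg (bc_proj k) (bc_proj_zmod k).
HB.instance Definition _ :=
  GRing.isZmodMorphism.Build bc_alg T bc_aug (tlift_zmod bc_aug_bal).

Lemma bc_projZ k a x : bc_proj k (calg_in bc_alg a * x) = calg_in bc_alg a * bc_proj k x.
Proof.
move: x; elim/tens_ind => [|x y hx hy|b x].
- by rewrite mulr0 raddf0 mulr0.
- by rewrite mulrDr !raddfD /= mulrDr hx hy.
by rewrite bc_proj_pure /= /tinl !pureM !mul1r bc_proj_pure.
Qed.

Lemma bc_proj_proj k l x : bc_proj k (bc_proj l x) = if k == l then bc_proj l x else 0.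
Proof.
move: x; elim/tens_ind => [|x y hx hy|b x].
- by rewrite !raddf0 if_same.
- by rewrite !raddfD /= hx hy; case: eqP => // _; rewrite addr0.
by rewrite !bc_proj_pure gproj_proj; case: eqP => // _; rewrite pure0r.
Qed.

Lemma sum_widen (Z : zmodType) (h : nat -> Z) n m : (n <= m)%N ->
  (forall k, (n <= k)%N -> h k = 0) -> \sum_(k < m) h k = \sum_(k < n) h k.
Proof.
move=> nm h0; rewrite -!(big_mkord xpredT) (big_cat_nat (n := n)) //=.
by rewrite [X in _ + X]big_nat_cond [X in _ + X]big1 ?addr0 // => k /andP[/andP[/h0->]].
Qed.

Lemma gproj_bound (B : galg S) (x : B) : exists n, forall k, (n <= k)%N -> gproj k x = 0.
Proof.
have [n ->] := gproj_sum x; exists n => k nk.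
rewrite raddf_sum big1 // => i _ /=; rewrite gproj_proj; case: eqP => // ki.
by move: nk; rewrite ki leqNgt ltn_ord.
Qed.

Lemma bc_proj_sum x : exists n, x = \sum_(k < n) bc_proj k x.
Proof.
suff [n [h1 h2]] : exists n, (forall k, (n <= k)%N -> bc_proj k x = 0) /\
    x = \sum_(k < n) bc_proj k x by exists n.
move: x; elim/tens_ind => [|x y [n [hx ex]] [m [hy ey]]|a x].
- by exists 0%N; split; rewrite ?big_ord0 // => k _; rewrite raddf0.
- exists (maxn n m); split=> [k|].
    by rewrite geq_max => /andP[nk mk]; rewrite raddfD /= hx // hy // addr0.
  under eq_bigr do rewrite raddfD /=; rewrite big_split /=.
  rewrite (@sum_widen _ (bc_proj^~ x) _ _ (leq_maxl n m)) //.
  by rewrite (@sum_widen _ (bc_proj^~ y) _ _ (leq_maxr n m)) // -ex -ey.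
have [n ex] := gproj_sum x.
have [m hm] := gproj_bound x.
exists (maxn n m); split=> [k|].
  by rewrite geq_max => /andP[nk mk]; rewrite bc_proj_pure hm // pure0r.
under eq_bigr do rewrite bc_proj_pure.
have pa : {morph (pure a : A -> tens T A) : u v / u + v} by move=> u v; rewrite pureDr.
rewrite -(big_morph _ pa (pure0r _ _)); congr (pure _ _).
have hn k : (n <= k)%N -> gproj k x = 0.
  move=> nk; rewrite ex raddf_sum big1 // => i _ /=; rewrite gproj_proj.
  by case: eqP => // ki; move: nk; rewrite ki leqNgt ltn_ord.
by rewrite (@sum_widen _ (gproj^~ x) _ _ (leq_maxl n m)).
Qed.

Lemma bc_projM k l x y : bc_proj (k + l) (bc_proj k x * bc_proj l y) = bc_proj k x * bc_proj l y.
Proof.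
move: x; elim/tens_ind => [|x x' hx hy|a x].
- by rewrite !raddf0 mul0r raddf0.
- by rewrite !raddfD /= mulrDl raddfD /= hx hy.
move: y; elim/tens_ind => [|y y' hx hy|b y].
- by rewrite !raddf0 mulr0 raddf0.
- by rewrite !raddfD /= mulrDr raddfD /= hx hy.
by rewrite !bc_proj_pure pureM bc_proj_pure gprojM.
Qed.

Lemma bc_proj0 x : bc_proj 0 x = calg_in bc_alg (bc_aug x).
Proof.
move: x; elim/tens_ind => [|x x' hx hy|a x].
- by rewrite !raddf0.
- by rewrite !raddfD /= hx hy.
by rewrite bc_proj_pure bc_aug_pure gproj0 /= rmorphM /= tin_bal -pureE.
Qed.

Lemma bc_augK a : bc_aug (calg_in bc_alg a) = a.
Proof. by rewrite /= /tinl bc_aug_pure -[1](rmorph1 (calg_in A)) gaugK rmorph1 mulr1. Qed.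

Definition bc : galg T :=
  GAlg bc_proj_zmod bc_projZ bc_proj_proj bc_proj_sum bc_projM bc_proj0 bc_augK.

Lemma bc_gproj_pure k a x : gproj (g := bc) k (pure a x) = pure a (gproj k x).
Proof. exact: bc_proj_pure. Qed.

End BaseChange.
Arguments bc {S} T A.

(* Elements of prod_k A_k as sequences of homogeneous elements. *)
Record cpl (S : comPzRingType) (A : galg S) := Cpl {
  cval :> nat -> A;
  cvalP : forall k, gproj k (cval k) = cval k }.

Section Completion.
Variables (S : comPzRingType) (A : galg S).

HB.instance Definition _ := gen_eqMixin (cpl A).
HB.instance Definition _ := gen_choiceMixin (cpl A).

Lemma cplP (x y : cpl A) : (forall k, x k = y k) -> x = y.
Proof.
case: x y => [x xP] [y yP] /= /funext xy; case: _ / xy yP => yP.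
by rewrite (Prop_irrelevance xP yP).
Qed.

Fact cpl0_subproof k : gproj k (0 : A) = 0. Proof. exact: raddf0. Qed.
Definition cpl0 : cpl A := @Cpl _ A (fun=> 0) cpl0_subproof.
Fact cplN_subproof (x : cpl A) k : gproj k (- x k) = - x k.
Proof. by rewrite raddfN /= cvalP. Qed.
Definition cplN x : cpl A := Cpl (cplN_subproof x).
Fact cplD_subproof (x y : cpl A) k : gproj k (x k + y k) = x k + y k.
Proof. by rewrite raddfD /= !cvalP. Qed.
Definition cplD x y : cpl A := Cpl (cplD_subproof x y).
Fact cplDA : associative cplD. Proof. by move=> *; apply: cplP => k /=; rewrite addrA. Qed.
Fact cplDC : commutative cplD. Proof. by move=> *; apply: cplP => k /=; rewrite addrC. Qed.
Fact cplD0 : left_id cpl0 cplD. Proof. by move=> *; apply: cplP => k /=; rewrite add0r. Qed.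
Fact cplDN : left_inverse cpl0 cplN cplD.
Proof. by move=> *; apply: cplP => k /=; rewrite addNr. Qed.
HB.instance Definition _ := GRing.isZmodule.Build (cpl A) cplDA cplDC cplD0 cplDN.

Fact csingle_subproof k (b : A) m :
  gproj m (if m == k then gproj k b else 0) = if m == k then gproj k b else 0.
Proof. by case: eqP => [->|_]; rewrite ?raddf0 // gproj_proj eqxx. Qed.
Definition csingle k b : cpl A := Cpl (csingle_subproof k b).

Fact cplM_subproof (x y : cpl A) n :
  gproj n (\sum_(i < n.+1) x i * y (n - i)%N) = \sum_(i < n.+1) x i * y (n - i)%N.
Proof.
rewrite raddf_sum; apply: eq_bigr => i _ /=.
by have := gprojM i (n - i) (x i) (y (n - i)%N); rewrite !cvalP subnKC // -ltnS.
Qed.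
Definition cplM x y : cpl A := Cpl (cplM_subproof x y).
Definition cpl1 : cpl A := csingle 0 1.

Fact cplMC : commutative cplM.
Proof.
move=> x y; apply: cplP => n /=.
rewrite (reindex_inj rev_ord_inj) /=; apply: eq_bigr => i _.
by rewrite mulrC subSS subKn // -ltnS.
Qed.

Fact cplM_rev (x y : cpl A) n : cplM x y n = \sum_(i < n.+1) x (n - i)%N * y i.
Proof. by rewrite cplMC /=; apply: eq_bigr => i _; rewrite mulrC. Qed.

Fact cplMA : associative cplM.
Proof.
move=> p q r; apply: cplP => i; rewrite [RHS]cplM_rev.
pose coef3 j k := p j * (q (i - j - k)%N * r k).
transitivity (\sum_(j < i.+1) \sum_(k < i.+1 | (k <= i - j)%N) coef3 j k).
  apply: eq_bigr => j _; rewrite (cplM_rev q r) big_distrr /=.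
  by rewrite (big_ord_narrow_leq (leq_subr _ _)).
rewrite (exchange_big_dep predT) //=; apply: eq_bigr => k _.
transitivity (\sum_(j < i.+1 | (j <= i - k)%N) coef3 j k).
  apply: eq_bigl => j; rewrite -ltnS -(ltnS j) -!subSn ?leq_ord //.
  by rewrite -subn_gt0 -(subn_gt0 j) -!subnDA addnC.
rewrite (big_ord_narrow_leq (leq_subr _ _)) big_distrl /=.
by apply: eq_bigr => j _; rewrite /coef3 -!subnDA addnC mulrA.
Qed.

Lemma gproj_1 k : gproj k (1 : A) = if k == 0%N then 1 else 0.
Proof. by rewrite -(rmorph1 (calg_in A)) gproj_in. Qed.

Fact cplM1 : left_id cpl1 cplM.
Proof.
move=> x; apply: cplP => n /=; rewrite big_ord_recl /= gproj_1 eqxx mul1r subn0.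
by rewrite big1 ?addr0 // => i _; rewrite mul0r.
Qed.
Fact cplMDl : left_distributive cplM +%R.
Proof.
by move=> x y z; apply: cplP => n /=; rewrite -big_split /=; under eq_bigr do rewrite mulrDl.
Qed.
HB.instance Definition _ :=
  GRing.Zmodule_isComPzRing.Build (cpl A) cplMA cplMC cplM1 cplMDl.

Lemma cplM_0 (x y : cpl A) : (x * y) 0%N = x 0%N * y 0%N.
Proof. exact: big_ord1. Qed.

Definition cin (s : S) : cpl A := csingle 0 (calg_in A s).
Fact cin_zmod : zmod_morphism cin.
Proof.
by move=> s t; apply: cplP => -[|k] /=; rewrite ?eqxx ?subrr // rmorphB raddfB.
Qed.
Fact cin_monoid : monoid_morphism cin.
Proof.
split; first by apply: cplP => k /=; rewrite rmorph1.
move=> s t; apply: cplP => -[|k] /=.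
  by rewrite big_ord1 /= !gproj_in eqxx rmorphM.
rewrite big_ord_recl /= mulr0 add0r big1 // => i _.
by rewrite mul0r.
Qed.
HB.instance Definition _ := GRing.isZmodMorphism.Build S (cpl A) cin cin_zmod.
HB.instance Definition _ := GRing.isMonoidMorphism.Build S (cpl A) cin cin_monoid.

End Completion.

Section CplMap.
Variables (S S' : comPzRingType) (A : galg S) (A' : galg S') (h : {rmorphism A -> A'}).

Definition graded := forall k x, h (gproj k x) = gproj k (h x).
Fact cmap_subproof (hP : graded) (x : cpl A) k : gproj k (h (x k)) = h (x k).
Proof. by rewrite -hP cvalP. Qed.
Definition cmap (hP : graded) x : cpl A' := Cpl (cmap_subproof hP x).

Hypothesis hP : graded.

Fact cmap_zmod : zmod_morphism (cmap hP).
Proof. by move=> x y; apply: cplP => k /=; rewrite rmorphB. Qed.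
Fact cmap_monoid : monoid_morphism (cmap hP).
Proof.
split=> [|x y]; apply: cplP => k /=.
  by rewrite !gproj_1 eqxx; case: eqP; rewrite ?rmorph1 ?rmorph0.
by rewrite rmorph_sum; apply: eq_bigr => i _ /=; rewrite rmorphM.
Qed.
HB.instance Definition _ := GRing.isZmodMorphism.Build _ _ (cmap hP) cmap_zmod.
HB.instance Definition _ := GRing.isMonoidMorphism.Build _ _ (cmap hP) cmap_monoid.
End CplMap.

Lemma rmorph_eq (A B : comPzRingType) (f g : {rmorphism A -> B}) : f =1 g -> f = g.
Proof.
case: f g => [f [[fD] [fM]]] [g [[gD] [gM]]] /= /funext fg.
case: _ / fg gD gM => gD gM.
by rewrite (Prop_irrelevance fD gD) (Prop_irrelevance fM gM).
Qed.

Section AlgHom.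
Variable S : comPzRingType.

Lemma ahom_eq (A B : calg S) (f g : ahom A B) : f =1 g -> f = g.
Proof.
case: f g => [f fP] [g gP] /= /rmorph_eq fg; case: _ / fg gP => gP.
by rewrite (Prop_irrelevance fP gP).
Qed.

Definition ahom_id (A : calg S) : ahom A A :=
  @AHom S A A idfun (fun=> erefl).

Fact ahom_comp_subproof (A B C : calg S) (g : ahom B C) (f : ahom A B) s :
  (g \o f) (calg_in A s) = calg_in C s.
Proof. by rewrite /= !ahomP. Qed.
Definition ahom_comp (A B C : calg S) (g : ahom B C) (f : ahom A B) : ahom A C :=
  @AHom S A C (g \o f) (ahom_comp_subproof g f).

Variables (A A' B B' : calg S) (u : ahom A A') (v : ahom B B').

Fact tmap_subproof s : (tinl B' \o u) (calg_in A s) = (@tinr _ A' B' \o v) (calg_in B s).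
Proof. by rewrite /= !ahomP tin_bal. Qed.
Definition tmap : {rmorphism tens A B -> tens A' B'} := tpush tmap_subproof.
Lemma tmap_inl a : tmap (tinl B a) = tinl B' (u a).
Proof. exact: tpush_inl. Qed.
Lemma tmap_inr b : tmap (tinr A b) = tinr A' (v b).
Proof. exact: tpush_inr. Qed.
Lemma tmap_pure a b : tmap (pure a b) = pure (u a) (v b).
Proof. by rewrite pureE rmorphM /= tmap_inl tmap_inr -pureE. Qed.
End AlgHom.

(* u (x) id on the completed base changes T (x) A^ -> T' (x) A^ *)
Section BaseChangeMap.
Variables (S : comPzRingType) (A : galg S).

Fact tmap_graded (T T' : calg S) (u : ahom T T') :
  graded (A := bc T A) (A' := bc T' A) (tmap u (ahom_id A)).
Proof.
move=> k; elim/tens_ind => [|x y hx hy|a b].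
- by rewrite !raddf0.
- by rewrite !raddfD /= hx hy.
by rewrite bc_gproj_pure !tmap_pure bc_gproj_pure.
Qed.
Definition cbc (T T' : calg S) (u : ahom T T') :
  {rmorphism cpl (bc T A) -> cpl (bc T' A)} := cmap (tmap_graded u).

Lemma cbcE (T T' : calg S) (u : ahom T T') x k : cbc u x k = tmap u (ahom_id A) (x k).
Proof. by []. Qed.

Fact tinr_graded (T : calg S) : graded (A := A) (A' := bc T A) (@tinr _ T A).
Proof. by move=> k x; rewrite bc_gproj_pure. Qed.
(* x |-> 1 (x) x *)
Definition cbc_in (T : calg S) : {rmorphism cpl A -> cpl (bc T A)} := cmap (tinr_graded T).

Lemma cbc_cin (T T' : calg S) (u : ahom T T') (t : T) :
  cbc u (cin (bc T A) t) = cin (bc T' A) (u t).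
Proof.
apply: cplP => k; rewrite cbcE; case: k => [|k]; last by rewrite raddf0.
rewrite -[cin _ t 0%N]/(gproj (g := bc T A) 0 (tinl A t)).
rewrite -[cin _ (u t) 0%N]/(gproj (g := bc T' A) 0 (tinl A (u t))).
by rewrite !bc_gproj_pure tmap_pure.
Qed.

Lemma cbc_in_nat (T T' : calg S) (u : ahom T T') (x : cpl A) :
  cbc u (cbc_in T x) = cbc_in T' x.
Proof. by apply: cplP => k; rewrite cbcE tmap_inr. Qed.

Lemma cbc_comp (T T' T'' : calg S) (u : ahom T T') (v : ahom T' T'') (w : ahom T T'') x :
  (forall t, w t = v (u t)) -> cbc v (cbc u x) = cbc w x.
Proof.
move=> h; apply: cplP => k; rewrite !cbcE; move: (cval x k); elim/tens_ind => [|y z hy hz|a b].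
- by rewrite !raddf0.
- by rewrite !raddfD /= hy hz.
by rewrite !tmap_pure h.
Qed.

Lemma cbc_id (T : calg S) (u : ahom T T) x : (forall t, u t = t) -> cbc u x = x.
Proof.
move=> h; apply: cplP => k; rewrite !cbcE; move: (cval x k); elim/tens_ind => [|y z hy hz|a b].
- by rewrite !raddf0.
- by rewrite !raddfD /= hy hz.
by rewrite !tmap_pure h.
Qed.
End BaseChangeMap.
Arguments cbc_in {S A} T.

Record hder (K S : comPzRingType) (j : {rmorphism K -> S}) (B : galg S) := HDer {
  hd :> {rmorphism S -> cpl B};
  hdK : forall c, hd (j c) = cin B (j c);
  hd0 : forall r, hd r 0%N = calg_in B r }.

Section HigherDerivations.
Variables (K S : comPzRingType) (j : {rmorphism K -> S}) (B : galg S).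

Definition positive (g : cpl B -> cpl B) :=
  forall k b i, (i < k)%N -> g (csingle k b) i = 0.

(* For additive g, continuity for the topology of the filtration by the ideals
   prod_(i >= k) B_i. *)
Definition cpl_continuous (g : cpl B -> cpl B) :=
  forall n, exists m, forall x y : cpl B,
    (forall i, (i < m)%N -> x i = y i) -> forall i, (i < n)%N -> g x i = g y i.

(* The part g^(i) of g raising degrees by i. *)
Fact gpart_subproof i (g : cpl B -> cpl B) (x : cpl B) m :
  let y := if (i <= m)%N then g (csingle (m - i)%N (x (m - i)%N)) m else 0 in
  gproj m y = y.
Proof. by case: ifP => _ /=; rewrite ?cvalP ?raddf0. Qed.
Definition gpart i g (x : cpl B) : cpl B := Cpl (gpart_subproof i g x).

Variable th : hder j B.

Definition iter_ext (g : {rmorphism cpl B -> cpl B}) :=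
  [/\ positive g, cpl_continuous g, forall c, g (cin B (j c)) = cin B (j c),
      forall s, g (cin B s) = th s
    & forall i k x, gpart i g (gpart k g x) = gpart (i + k) g x *+ 'C(i + k, i)].

Definition iterable :=
  generates (fun b : B => exists k r, b = th r k) /\ exists g, iter_ext g.

Definition is_const : {pred S} := fun r => `[< th r = cin B r >].

Definition const_base := forall r, r \in is_const <-> exists c, r = j c.

Fact is_const_subring : subring_closed is_const.
Proof.
split; first by apply/asboolP; rewrite !rmorph1.
  by move=> x y /asboolP hx /asboolP hy; apply/asboolP; rewrite !rmorphB /= hx hy.
by move=> x y /asboolP hx /asboolP hy; apply/asboolP; rewrite !rmorphM /= hx hy.
Qed.

Record csts := Cst { cst_val : S; cst_valP : cst_val \in is_const }.
HB.instance Definition _ := [isSub for cst_val].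
HB.instance Definition _ := [Choice of csts by <:].
HB.instance Definition _ := GRing.SubChoice_isSubComPzRing.Build _ _ csts is_const_subring.

Fact cst_in_subproof c : j c \in is_const.
Proof. by apply/asboolP; rewrite hdK. Qed.
Definition cst_in c : csts := Cst (cst_in_subproof c).
Fact cst_in_zmod : zmod_morphism cst_in.
Proof. by move=> x y; apply: val_inj; rewrite /= rmorphB. Qed.
Fact cst_in_monoid : monoid_morphism cst_in.
Proof. by split=> [|x y]; apply: val_inj; rewrite /= (rmorph1, rmorphM). Qed.
HB.instance Definition _ := GRing.isZmodMorphism.Build K csts cst_in cst_in_zmod.
HB.instance Definition _ := GRing.isMonoidMorphism.Build K csts cst_in cst_in_monoid.

Definition const_alg : calg K := CAlg cst_in.

End HigherDerivations.

Record gfunctor (K : comPzRingType) := GFunctor {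
  gf_ob :> calg K -> groupType;
  gf_mor : forall L L', ahom L L' -> gf_ob L -> gf_ob L';
  gf_morM : forall L L' (f : ahom L L') x y,
    gf_mor f (x * y)%g = (gf_mor f x * gf_mor f y)%g;
  gf_id : forall L x, gf_mor (ahom_id L) x = x;
  gf_comp : forall L L' L'' (g : ahom L' L'') (f : ahom L L') x,
    gf_mor (ahom_comp g f) x = gf_mor g (gf_mor f x) }.

(* The underlying functor to sets is naturally isomorphic to Hom_K(U, -). *)
Definition represents (K : comPzRingType) (U : calg K) (G : gfunctor K) :=
  exists Phi : forall L, ahom U L -> G L,
    (forall L, bijective (Phi L)) /\
    forall L L' (f : ahom L L') (p : ahom U L),
      Phi L' (ahom_comp f p) = gf_mor f (Phi L p).

Section ThetaRings.
Variables (K F : fieldType) (iK : {rmorphism K -> F}) (Om : galg F) (theta : hder iK Om).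

Record thring := ThRing {
  tr_alg :> calg F;
  tr_hd : hder (calg_in tr_alg \o iK) (bc tr_alg Om);
  tr_ext : forall t, tr_hd (calg_in tr_alg t) = cbc_in tr_alg (theta t);
  tr_iter : iterable tr_hd }.

(* For an ideal I, the image of I (x)_F Om_k in R (x)_F Om_k. *)
Definition tens_ideal (R : calg F) (I : R -> Prop) k (x : tens R Om) :=
  exists2 s : seq (R * Om), x = \sum_(p <- s) pure p.1 p.2
    & forall p, p \in s -> I p.1 /\ gproj k p.2 = p.2.

Definition theta_ideal (R : thring) (I : R -> Prop) :=
  [/\ I 0, forall x y, I x -> I y -> I (x + y), forall r x, I x -> I (r * x)
    & forall k x, I x -> tens_ideal I k (tr_hd R x k)].

(* As usual for simple rings, the zero ring is excluded. *)
Definition theta_simple (R : thring) :=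
  (1 : R) <> 0 /\
  forall I : R -> Prop, theta_ideal I -> (forall x, I x -> x = 0) \/ (forall x, I x).

Definition inGL (T : comPzRingType) n (A : 'M[T]_n) :=
  exists B : 'M[T]_n, A *m B = 1%:M /\ B *m A = 1%:M.

Definition mx_part (k : nat) n (A : 'M[cpl Om]_n) : 'M[cpl Om]_n :=
  map_mx (fun x : cpl Om => csingle k (x k)) A.

(* The extension g of theta to the completion is unique when theta is iterable,
   since Om is then generated by the coefficients of theta. *)
Definition iter_diff_eq n (A : 'M[cpl Om]_n) :=
  [/\ inGL A, mx_part 0 A = 1%:M
    & exists2 g, iter_ext theta g
      & forall k l, mx_part (k + l) A *+ 'C(k + l, l) =
          \sum_(i < l.+1) map_mx (gpart i g) (mx_part k A) *m mx_part (l - i) A].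

Definition PPV_for n (A : 'M[cpl Om]_n) (R : thring) :=
  [/\ theta_simple R,
      exists Y : 'M[R]_n, exists d : R,
        [/\ inGL Y, map_mx (tr_hd R) Y = map_mx (cbc_in R) A *m map_mx (cin (bc R Om)) Y,
            \det Y * d = 1
          & generates (A := R) (fun x => (exists i j, x = Y i j) \/ x = d)]
    & const_base (tr_hd R)].

Definition PPV (R : thring) :=
  exists n, exists A : 'M[cpl Om]_n, iter_diff_eq A /\ PPV_for A R.

Section TensorProduct.
Variables R R' : thring.

Definition tens_calg : calg F := CAlg (tinl R' \o calg_in R).
Definition ahom_inl : ahom R tens_calg := @AHom F R tens_calg (@tinl _ R R') (fun=> erefl).
Definition ahom_inr : ahom R' tens_calg :=
  @AHom F R' tens_calg (@tinr _ R R') (fun s => esym (tin_bal R R' s)).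

Fact tens_hd_subproof s :
  (cbc Om ahom_inl \o tr_hd R) (calg_in R s) = (cbc Om ahom_inr \o tr_hd R') (calg_in R' s).
Proof.
rewrite -[LHS]/(cbc Om ahom_inl (tr_hd R _)) -[RHS]/(cbc Om ahom_inr (tr_hd R' _)).
by rewrite !tr_ext !cbc_in_nat.
Qed.

(* r (x) r' |-> theta_R(r) theta_R'(r'), by the Cauchy product in the completion *)
Definition tens_hd : {rmorphism tens_calg -> cpl (bc tens_calg Om)} :=
  tpush tens_hd_subproof.

Fact tens_hdK c : tens_hd ((calg_in tens_calg \o iK) c) =
  cin (bc tens_calg Om) ((calg_in tens_calg \o iK) c).
Proof.
rewrite [LHS](tpush_inl tens_hd_subproof) -[LHS]/(cbc Om ahom_inl (tr_hd R _)).
by rewrite [tr_hd R _](hdK (tr_hd R) c) cbc_cin.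
Qed.

Fact tens_hd0 r : tens_hd r 0%N = calg_in (bc tens_calg Om) r.
Proof.
move: r; elim/tens_ind => [|x y hx hy|a b].
- by rewrite !raddf0.
- by rewrite !raddfD /= hx hy.
have -> : tens_hd (pure a b) = cbc Om ahom_inl (tr_hd R a) * cbc Om ahom_inr (tr_hd R' b).
  exact: tpush_pure.
rewrite cplM_0 !cbcE !hd0 pureE rmorphM.
by congr (_ * _); apply: tmap_inl.
Qed.
Definition hder_tens : hder (calg_in tens_calg \o iK) (bc tens_calg Om) :=
  HDer tens_hdK tens_hd0.
End TensorProduct.

Section ScalarExtension.
Variable R : thring.
Definition RK : calg K := CAlg (calg_in R \o iK).
Definition FK : calg K := CAlg iK.
Definition inRK : ahom FK RK := @AHom K FK RK (calg_in R) (fun=> erefl).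

Definition FL (L : calg K) : comPzRingType := tens FK L.
(* R_L as an F_L-algebra *)
Definition RL (L : calg K) : calg (FL L) := CAlg (tmap inRK (ahom_id L)).
(* R_L as an F-algebra; theta on R_L takes its values in the completion of
   R_L (x)_F Om, which is R_L (x)_(F_L) (F_L (x)_F Om). *)
Definition RLF (L : calg K) : calg F := CAlg (calg_in (RL L) \o tinl L).

Section ExtendTheta.
Variable L : calg K.

Fact inRL_subproof t : @tinl K RK L (calg_in R t) = calg_in (RLF L) t.
Proof. by rewrite [RHS](tmap_inl inRK (ahom_id L)). Qed.
Definition inRL : ahom R (RLF L) :=
  @AHom F R (RLF L) (@tinl K RK L : {rmorphism RK -> tens RK L}) inRL_subproof.

Let ext_u : {rmorphism RK -> cpl (bc (RLF L) Om)} := cbc Om inRL \o tr_hd R.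
Let ext_v : {rmorphism L -> cpl (bc (RLF L) Om)} :=
  @cin (RLF L) (bc (RLF L) Om) \o (@tinr K RK L : {rmorphism L -> tens RK L}).

Fact ext_hd_subproof c : ext_u (calg_in RK c) = ext_v (calg_in L c).
Proof.
rewrite -[LHS]/(cbc Om inRL (tr_hd R _)) [tr_hd R _](hdK (tr_hd R) c) cbc_cin.
by congr cin; apply: tin_bal.
Qed.

(* r (x) a |-> theta_R(r) (x) a *)
Definition ext_hd : {rmorphism RLF L -> cpl (bc (RLF L) Om)} := tpush ext_hd_subproof.
Lemma ext_hd_inl r : ext_hd (@tinl K RK L r) = cbc Om inRL (tr_hd R r).
Proof. exact: (tpush_inl ext_hd_subproof). Qed.
Lemma ext_hd_inr a : ext_hd (@tinr K RK L a) = cin (bc (RLF L) Om) (@tinr K RK L a).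
Proof. exact: (tpush_inr ext_hd_subproof). Qed.

Fact ahomF_subproof (f : ahom (RL L) (RL L)) t :
  f (calg_in (RLF L) t) = calg_in (RLF L) t.
Proof. exact: ahomP. Qed.
Definition ahomF (f : ahom (RL L) (RL L)) : ahom (RLF L) (RLF L) :=
  @AHom F (RLF L) (RLF L) f (ahomF_subproof f).

Definition commutes_theta (f : ahom (RL L) (RL L)) :=
  forall y, ext_hd (f y) = cbc Om (ahomF f) (ext_hd y).

(* Ring automorphisms are F_L-linear exactly when they are F_L-algebra morphisms. *)
Record thaut := ThAut {
  ta_fun :> ahom (RL L) (RL L);
  ta_bij : bijective ta_fun;
  ta_comm : commutes_theta ta_fun }.

HB.instance Definition _ := gen_eqMixin thaut.
HB.instance Definition _ := gen_choiceMixin thaut.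

Lemma thaut_eq (f g : thaut) : f =1 g -> f = g.
Proof.
case: f g => [f fP fQ] [g gP gQ] /= h; have fg : f = g by apply: ahom_eq.
case: _ / fg gP gQ {h} => gP gQ.
by rewrite (Prop_irrelevance fP gP) (Prop_irrelevance fQ gQ).
Qed.

Fact thaut1_comm : commutes_theta (ahom_id (RL L)).
Proof. by move=> y; symmetry; apply: cbc_id. Qed.
Definition thaut1 := @ThAut (ahom_id (RL L)) (@Bijective _ _ idfun idfun (frefl _) (frefl _)) thaut1_comm.

Fact thautM_comm (f g : thaut) : commutes_theta (ahom_comp f g).
Proof.
move=> y; rewrite -[LHS]/(ext_hd (f (g y))) (ta_comm f) (ta_comm g).
by apply: cbc_comp.
Qed.
Definition thautM (f g : thaut) := 
  @ThAut (ahom_comp f g) (bij_comp (ta_bij f) (ta_bij g)) (@thautM_comm f g).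

Section Inverse.
Variable f : thaut.
Let inv_ex : exists g, cancel f g /\ cancel g f.
Proof. by case: (ta_bij f) => g; exists g. Qed.
Definition thinv_fun : RL L -> RL L := projT1 (cid inv_ex).
Let fK : cancel f thinv_fun. Proof. by case: (projT2 (cid inv_ex)). Qed.
Let Kf : cancel thinv_fun f. Proof. by case: (projT2 (cid inv_ex)). Qed.
Fact thinv_zmod : zmod_morphism thinv_fun.
Proof. by move=> x y; apply: (can_inj fK); rewrite rmorphB !Kf. Qed.
Fact thinv_monoid : monoid_morphism thinv_fun.
Proof. by split=> [|x y]; apply: (can_inj fK); rewrite (rmorph1, rmorphM) !Kf. Qed.
HB.instance Definition _ := GRing.isZmodMorphism.Build _ _ thinv_fun thinv_zmod.
HB.instance Definition _ := GRing.isMonoidMorphism.Build _ _ thinv_fun thinv_monoid.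
Fact thinvP s : thinv_fun (calg_in (RL L) s) = calg_in (RL L) s.
Proof. by apply: (can_inj fK); rewrite Kf ahomP. Qed.
Definition thinv_hom : ahom (RL L) (RL L) := @AHom _ (RL L) (RL L) thinv_fun thinvP.
Fact thinv_comm : commutes_theta thinv_hom.
Proof.
move=> y; rewrite -{2}[y]Kf (ta_comm f).
rewrite (@cbc_comp _ _ _ _ _ (ahomF f) (ahomF thinv_hom) (ahom_id (RLF L))).
  by rewrite cbc_id.
by move=> t; symmetry; apply: fK.
Qed.
Definition thautV := 
  @ThAut thinv_hom (@Bijective _ _ thinv_hom f Kf fK) thinv_comm.
Lemma thautVl : thautM thautV f = thaut1.
Proof. by apply: thaut_eq => x /=; rewrite fK. Qed.
Lemma thautVr : thautM f thautV = thaut1.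
Proof. by apply: thaut_eq => x /=; rewrite Kf. Qed.
End Inverse.

Fact thautA : associative thautM. Proof. by move=> f g h; apply: thaut_eq. Qed.
Fact thaut1l : left_id thaut1 thautM. Proof. by move=> f; apply: thaut_eq. Qed.
Fact thaut1r : right_id thaut1 thautM. Proof. by move=> f; apply: thaut_eq. Qed.
HB.instance Definition _ := isGroup.Build thaut thautA thaut1l thaut1r thautVl thautVr.
End ExtendTheta.

Lemma RL_inl L t : @tinl K RK L (calg_in R t) = calg_in (RL L) (@tinl K FK L t).
Proof. by rewrite [RHS](tmap_inl inRK (ahom_id L)). Qed.
Lemma RL_inr L a : @tinr K RK L a = calg_in (RL L) (@tinr K FK L a).
Proof. by rewrite [RHS](tmap_inr inRK (ahom_id L)). Qed.

Lemma RL_ext L (C : comPzRingType) (f g : {rmorphism RL L -> C}) :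
  (forall r, f (@tinl K RK L r) = g (@tinl K RK L r)) ->
  (forall a, f (@tinr K RK L a) = g (@tinr K RK L a)) -> f =1 g.
Proof. exact: tens_rext. Qed.

Section BaseChangeAut.
Variables (L L' : calg K) (p : ahom L L').

Definition RL_map : {rmorphism RL L -> RL L'} := tmap (ahom_id RK) p.
Lemma RL_map_inl r : RL_map (@tinl K RK L r) = @tinl K RK L' r.
Proof. exact: (tmap_inl (ahom_id RK) p). Qed.
Lemma RL_map_inr a : RL_map (@tinr K RK L a) = @tinr K RK L' (p a).
Proof. exact: (tmap_inr (ahom_id RK) p). Qed.

Fact RL_mapF_subproof t : RL_map (calg_in (RLF L) t) = calg_in (RLF L') t.
Proof.
by rewrite -[calg_in (RLF L) t]RL_inl RL_map_inl RL_inl.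
Qed.
Definition RL_mapF : ahom (RLF L) (RLF L') := @AHom F (RLF L) (RLF L') RL_map RL_mapF_subproof.

Lemma ext_hd_nat y : ext_hd L' (RL_map y) = cbc Om RL_mapF (ext_hd L y).
Proof.
pose f : {rmorphism RL L -> cpl (bc (RLF L') Om)} := ext_hd L' \o RL_map.
pose g : {rmorphism RL L -> cpl (bc (RLF L') Om)} := cbc Om RL_mapF \o ext_hd L.
rewrite -[LHS]/(f y) -[RHS]/(g y); apply: RL_ext => {}y.
  rewrite -[LHS]/(ext_hd L' (RL_map _)) -[RHS]/(cbc Om RL_mapF (ext_hd L _)).
  rewrite RL_map_inl !ext_hd_inl.
  by symmetry; apply: cbc_comp => r; symmetry; apply: RL_map_inl.
rewrite -[LHS]/(ext_hd L' (RL_map _)) -[RHS]/(cbc Om RL_mapF (ext_hd L _)).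
by rewrite RL_map_inr !ext_hd_inr cbc_cin; congr cin; symmetry; apply: RL_map_inr.
Qed.

Section One.
Variable f : thaut L.

Let bch_u : {rmorphism RK -> RL L'} :=
  RL_map \o ta_fun f \o (@tinl K RK L : {rmorphism RK -> tens RK L}).
Let bch_v : {rmorphism L' -> RL L'} := @tinr K RK L' : {rmorphism L' -> tens RK L'}.

Fact bch_subproof c : bch_u (calg_in RK c) = bch_v (calg_in L' c).
Proof.
rewrite -[LHS]/(RL_map (f (@tinl K RK L (calg_in R (iK c))))).
by rewrite RL_inl ahomP -RL_inl RL_map_inl; apply: (@tin_bal K RK L').
Qed.

(* r (x) a' |-> f(r (x) 1) (1 (x) a') *)
Definition bch_fun : {rmorphism RL L' -> RL L'} := tpush bch_subproof.

Lemma bch_inl r : bch_fun (@tinl K RK L' r) = RL_map (f (@tinl K RK L r)).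
Proof. exact: (tpush_inl bch_subproof). Qed.
Lemma bch_inr a : bch_fun (@tinr K RK L' a) = @tinr K RK L' a.
Proof. exact: (tpush_inr bch_subproof). Qed.

Lemma bch_map y : bch_fun (RL_map y) = RL_map (f y).
Proof.
pose g : {rmorphism RL L -> RL L'} := bch_fun \o RL_map.
pose h : {rmorphism RL L -> RL L'} := RL_map \o ta_fun f.
rewrite -[LHS]/(g y) -[RHS]/(h y); apply: RL_ext => {}y.
  by rewrite -[LHS]/(bch_fun (RL_map _)) RL_map_inl bch_inl.
rewrite -[LHS]/(bch_fun (RL_map _)) -[RHS]/(RL_map (f _)) RL_map_inr bch_inr.
by rewrite (@RL_inr L) ahomP -RL_inr RL_map_inr.
Qed.

Fact bchP x : bch_fun (calg_in (RL L') x) = calg_in (RL L') x.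
Proof.
pose g : {rmorphism tens FK L' -> RL L'} := bch_fun \o calg_in (RL L').
rewrite -[LHS]/(g x); move: x; apply: tens_rext => x.
  rewrite -[LHS]/(bch_fun (calg_in (RL L') _)) -RL_inl bch_inl.
  by rewrite (RL_inl L) ahomP -RL_inl RL_map_inl.
by rewrite -[LHS]/(bch_fun (calg_in (RL L') _)) -RL_inr bch_inr.
Qed.
Definition bch_hom : ahom (RL L') (RL L') := AHom bchP.

Fact bch_comm : commutes_theta bch_hom.
Proof.
move=> y.
pose g : {rmorphism RL L' -> cpl (bc (RLF L') Om)} := ext_hd L' \o bch_fun.
pose h : {rmorphism RL L' -> cpl (bc (RLF L') Om)} := cbc Om (ahomF bch_hom) \o ext_hd L'.
rewrite -[LHS]/(g y) -[RHS]/(h y); apply: RL_ext => {}y.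
  rewrite -[LHS]/(ext_hd L' (bch_fun _)) -[RHS]/(cbc Om (ahomF bch_hom) (ext_hd L' _)).
  rewrite bch_inl ext_hd_nat (ta_comm f) -RL_map_inl ext_hd_nat.
  rewrite (@cbc_comp _ _ _ _ _ _ _ (ahom_comp RL_mapF (ahomF f)) _ (fun=> erefl)).
  by symmetry; apply: cbc_comp => t; symmetry; apply: bch_map.
rewrite -[LHS]/(ext_hd L' (bch_fun _)) -[RHS]/(cbc Om (ahomF bch_hom) (ext_hd L' _)).
by rewrite bch_inr ext_hd_inr cbc_cin; congr cin; symmetry; apply: bch_inr.
Qed.
End One.

Lemma bch_M (f g h : thaut L) : (forall y, f (g y) = h y) ->
  forall y, bch_fun f (bch_fun g y) = bch_fun h y.
Proof.
move=> fgh; pose k : {rmorphism RL L' -> RL L'} := bch_fun f \o bch_fun g.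
move=> y; rewrite -[LHS]/(k y); apply: RL_ext => {}y.
  by rewrite -[LHS]/(bch_fun f (bch_fun g _)) !bch_inl bch_map fgh.
by rewrite -[LHS]/(bch_fun f (bch_fun g _)) !bch_inr.
Qed.

Lemma bch_1 (f : thaut L) : (forall y, f y = y) -> forall y, bch_fun f y = y.
Proof.
move=> f1 y; rewrite -[RHS]/((idfun : {rmorphism RL L' -> RL L'}) y).
by apply: RL_ext => {}y /=; rewrite ?bch_inl ?bch_inr // f1 RL_map_inl.
Qed.

Fact bch_bij f : bijective (bch_hom f).
Proof.
exists (bch_hom (thautV f)) => y.
  rewrite -[LHS]/(bch_fun (thautV f) (bch_fun f y)) (@bch_M _ _ (thaut1 L)) ?bch_1 //.
  by move=> x; rewrite -[LHS]/((thautM (thautV f) f) x) thautVl.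
rewrite -[LHS]/(bch_fun f (bch_fun (thautV f) y)) (@bch_M _ _ (thaut1 L)) ?bch_1 //.
by move=> x; rewrite -[LHS]/((thautM f (thautV f)) x) thautVr.
Qed.

Definition bch (f : thaut L) : thaut L' := ThAut (bch_bij f) (bch_comm f).
End BaseChangeAut.

Fact bch_morM L L' (p : ahom L L') (f g : thaut L) : bch p (f * g)%g = (bch p f * bch p g)%g.
Proof. by apply: thaut_eq => y; symmetry; apply: bch_M. Qed.

Fact bch_idP L (f : thaut L) : bch (ahom_id L) f = f.
Proof.
apply: thaut_eq => y; rewrite -[LHS]/(bch_fun (ahom_id L) f y).
apply: RL_ext => {}y; last by rewrite bch_inr (@RL_inr L) ahomP.
rewrite bch_inl; move: (f _) => {}y.
rewrite -[RHS]/((idfun : {rmorphism RL L -> RL L}) y); apply: RL_ext => {}y.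
  exact: RL_map_inl.
exact: RL_map_inr.
Qed.

Fact bch_compP L L' L'' (q : ahom L' L'') (p : ahom L L') (f : thaut L) :
  bch (ahom_comp q p) f = bch q (bch p f).
Proof.
apply: thaut_eq => y.
rewrite -[LHS]/(bch_fun (ahom_comp q p) f y) -[RHS]/(bch_fun q (bch p f) y).
apply: RL_ext => {}y; last by rewrite !bch_inr.
rewrite !bch_inl.
move: (f _) => {}y.
pose g : {rmorphism RL L -> RL L''} := RL_map q \o RL_map p.
rewrite -[RHS]/(g y); apply: RL_ext => {}y; rewrite -[RHS]/(RL_map q (RL_map p _)).
  by rewrite !RL_map_inl.
by rewrite !RL_map_inr.
Qed.

Definition Aut_theta : gfunctor K :=
  @GFunctor K (fun L => thaut L : groupType) bch bch_morM bch_idP bch_compP.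
End ScalarExtension.
End ThetaRings.

(* Main.v *)
(* Let T = R (x)_F R and let U be its ring of constants.  The entries of
   (Y^-1 (x) 1)(1 (x) Y) are constants of T which generate it over R (x) 1, and by
   theta-simplicity elements of U satisfy over R only the relations they satisfy
   over K; hence R (x)_K U = T.  An automorphism f of R_L yields the
   theta-morphism T -> R_L, r (x) r' |-> r f(r'), which maps U to the constants
   L of R_L and is determined by this K-algebra map p : U -> L.  Conversely
   every p extends to R (x)_K U = T, which gives an endomorphism of R_L whose
   inverse comes from p composed with the exchange of the factors of T. *)

Require Import Defs.
From HB Require Import structures.
From mathcomp Require Import all_boot all_order all_algebra.
From mathcomp Require Import boolp classical_sets.

Set Implicit Arguments.
Unset Strict Implicit.
Unset Printing Implicit Defensive.

Import GRing.Theory.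
Local Open Scope classical_set_scope.
Local Open Scope ring_scope.

(** * Linear forms over a field, obtained by Zorn's lemma *)

Section LinearForms.
Variables (k : fieldType) (V : calg k).

Record linform := LinForm {
  lf :> V -> k;
  lfD : {morph lf : x y / x + y};
  lfZ : forall c x, lf (calg_in V c * x) = c * lf x }.

Definition subspace (W : V -> Prop) :=
  [/\ W 0, forall x y, W x -> W y -> W (x + y)
    & forall c x, W x -> W (calg_in V c * x)].

Lemma subspaceN W x : subspace W -> W x -> W (- x).
Proof. by case=> _ _ WZ Wx; rewrite -mulN1r -(rmorph1 (calg_in V)) -rmorphN; apply: WZ. Qed.

(** A subspace maximal among those containing [W] and avoiding [b] works: adjoining an [x] outside
    it must capture [b], and the resulting relation can be solved for [x]. *)
Lemma maximal_avoiding_subspace (W : V -> Prop) b : subspace W -> ~ W b ->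
  exists M : V -> Prop, [/\ subspace M, forall x, W x -> M x, ~ M b &
    forall x, exists c y, M y /\ x = calg_in V c * b + y].
Proof.
move=> Wsub Wb.
(* [Zorn_bigcup] also tests the empty chain, whose union is empty; adjoining [W] to [A] makes that
   union admissible. The alternative [X = set0] below serves the same case. *)
pose E (A : set V) : V -> Prop := fun x => W x \/ A x.
pose P (A : set V) := subspace (E A) /\ ~ E A b.
have P0 : P set0.
  have e : E set0 = W by apply/funext=> x; apply/propext; split=> [[]|] //; left.
  by rewrite /P e.
have [F FP Ftot|A [[EA EAb] Amax]] := @Zorn_bigcup V P.
  pose G := \bigcup_(X in F) X.
  have pick x : E G x -> exists2 X, E X x & P X /\ (X = set0 \/ F X).
    case=> [Wx|[X FX Xx]]; first by exists set0; [left|split; [|left]].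
    by exists X; [right|split; [exact: FP|right]].
  have up X x : (X = set0 \/ F X) -> E X x -> E G x.
    by move=> XF [Wx|Xx]; [left|right; case: XF Xx => [->//|FX Xx]; exists X].
  split; last by move=> /pick[X Xb [[_ /(_ Xb)]]].
  have le X Y x : (forall z, X z -> Y z) -> E X x -> E Y x.
    by move=> XY [Wx|/XY Yx]; [left|right].
  split; first by left; case: Wsub.
    move=> x y /pick[X Xx [[Xs _] XF]] /pick[Y Yy [[Ys _] YF]].
    have [XY|YX] : (forall z, X z -> Y z) \/ (forall z, Y z -> X z).
      case: XF YF => [->|FX] [->|FY]; [by left|by left|by right|exact: Ftot].
    - by apply: (up Y) YF _; case: Ys => _ YD _; apply: YD (le _ _ _ XY Xx) Yy.
    - by apply: (up X) XF _; case: Xs => _ XD _; apply: XD Xx (le _ _ _ YX Yy).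
  by move=> c x /pick[X Xx [[[_ _ XZ] _] XF]]; apply: (up X) XF _; apply: XZ.
exists (E A); split=> [||//|x]; [exact: EA|by move=> x Wx; left|].
have [Ax|nAx] := pselect (E A x); first by exists 0, x; rewrite rmorph0 mul0r add0r.
case: (EA) => EA0 EAD EAZ.
pose B : set V := fun y => exists c z, E A z /\ y = calg_in V c * x + z.
have AB z : E A z -> B z by move=> Az; exists 0, z; rewrite rmorph0 mul0r add0r.
have Bx : B x by exists 1, 0; rewrite rmorph1 mul1r addr0.
have EB : E B = B.
  by apply/funext=> z; apply/propext; split=> [[Wz|//]|]; [apply: AB; left|right].
have Bsub : subspace B.
  split; first exact: AB.
    move=> _ _ [c [z [Az ->]]] [c' [z' [Az' ->]]]; exists (c + c'), (z + z').
    by rewrite rmorphD mulrDl addrACA; split=> //; apply: EAD.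
  move=> c _ [c' [z [Az ->]]]; exists (c * c'), (calg_in V c * z).
  by rewrite rmorphM mulrDr mulrA; split=> //; apply: EAZ.
have /contrapT : ~ ~ B b.
  move=> nBb; have : P B by rewrite /P EB.
  apply: Amax; split=> [z Az|BA]; first by apply: AB; right.
  by apply: nAx; right; apply: BA.
case=> c [z [Az bE]].
(* The coefficient [c] of [x] cannot vanish, since [b] would then lie in [E A]. *)
have [c0|cn0] := eqVneq c 0.
  by case: EAb; rewrite bE c0 rmorph0 mul0r add0r.
exists c^-1, (calg_in V c^-1 * - z); split; first exact: EAZ (subspaceN EA Az).
by rewrite -mulrDr bE addrK mulrA -rmorphM mulVf // rmorph1 mul1r.
Qed.

Lemma exists_linform (W : V -> Prop) b : subspace W -> ~ W b ->
  exists l : linform, l b = 1 /\ forall x, W x -> l x = 0.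
Proof.
move=> Wsub Wb; have [M [Msub WM Mb span]] := maximal_avoiding_subspace Wsub Wb.
case: (Msub) => M0 MD MZ.
have [l lP] := choice span.
(* The form is the coordinate along [b]. It is well defined: two different values would put a
   non-zero multiple of [b], hence [b] itself, in [M]. *)
have lE c y : M y -> l (calg_in V c * b + y) = c.
  move=> My; have [z [Mz e]] := lP (calg_in V c * b + y).
  apply: subr0_eq; have [//|n0] := eqVneq (l (calg_in V c * b + y) - c) 0; case: Mb.
  set a := l _ in e n0.
  rewrite -[b]mul1r -(rmorph1 (calg_in V)) -(mulVf n0) rmorphM -mulrA; apply: (MZ).
  have -> : calg_in V (a - c) * b = y - z.
    by rewrite rmorphB mulrBl; apply/eqP; rewrite subr_eq addrAC eq_sym subr_eq -e addrC.
  exact: MD (subspaceN Msub Mz).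
have lD : {morph l : x y / x + y}.
  move=> x x'; have [[y [My e]] [y' [My' e']]] := (lP x, lP x').
  by rewrite {1}e {1}e' addrACA -mulrDl -rmorphD lE //; apply: MD.
have lZ c x : l (calg_in V c * x) = c * l x.
  have [y [My e]] := lP x.
  by rewrite {1}e mulrDr mulrA -rmorphM lE //; apply: MZ.
exists (LinForm lD lZ); split=> [|x /WM Mx] /=.
  by rewrite -[b]mul1r -[1]addr0 -(rmorph1 (calg_in V)) mulrDl mul0r lE.
by rewrite -[x]add0r -[0](mul0r b) -(rmorph0 (calg_in V)) lE.
Qed.

Lemma lf0 (l : linform) : l 0 = 0.
Proof. by rewrite -(mul0r 0) -(rmorph0 (calg_in V)) lfZ mul0r. Qed.

End LinearForms.

(** * Contractions of a tensor product by linear forms *)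

Section Evaluation.
Variables (k : fieldType) (A B : calg k).

(** With scalars embedded by the structure maps, [tevr l] is id (x) l and [tevl l] is l (x) id. *)
Definition tevr (l : linform B) : tens A B -> A :=
  tlift (fun a b => a * calg_in A (l b)).
Definition tevl (l : linform A) : tens A B -> B :=
  tlift (fun a b => calg_in B (l a) * b).

Lemma tevr_bal (l : linform B) : balanced (fun (a : A) b => a * calg_in A (l b)).
Proof.
split=> [*|*|c a b]; first by rewrite mulrDl.
  by rewrite lfD rmorphD mulrDr.
by rewrite lfZ rmorphM mulrA [a * _]mulrC.
Qed.
Lemma tevl_bal (l : linform A) : balanced (fun a (b : B) => calg_in B (l a) * b).
Proof.
split=> *; first by rewrite lfD rmorphD mulrDl.
  by rewrite mulrDr.
by rewrite lfZ rmorphM mulrCA mulrA.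
Qed.

HB.instance Definition _ l :=
  GRing.isZmodMorphism.Build (tens A B) A (tevr l) (tlift_zmod (tevr_bal l)).
HB.instance Definition _ l :=
  GRing.isZmodMorphism.Build (tens A B) B (tevl l) (tlift_zmod (tevl_bal l)).

Lemma tevr_pure l a b : tevr l (pure a b) = a * calg_in A (l b).
Proof. exact: tlift_pure (tevr_bal l) _ _. Qed.
Lemma tevl_pure l a b : tevl l (pure a b) = calg_in B (l a) * b.
Proof. exact: tlift_pure (tevl_bal l) _ _. Qed.

Lemma tevr_inlM l a z : tevr l (tinl B a * z) = a * tevr l z.
Proof.
move: z; elim/tens_ind => [|x y hx hy|a' b]; first by rewrite mulr0 raddf0 mulr0.
  by rewrite mulrDr !raddfD /= hx hy mulrDr.
by rewrite /tinl pureM mul1r !tevr_pure mulrA.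
Qed.

Lemma tens_seqE (z : tens A B) :
  exists n (a : 'I_n -> A) (b : 'I_n -> B), z = \sum_i pure (a i) (b i).
Proof.
exists (size (repr z)), (fun i => (tnth (in_tuple (repr z)) i).1),
  (fun i => (tnth (in_tuple (repr z)) i).2).
by rewrite {1}(tensE z) big_tnth.
Qed.

(* Shorten a representation of z whenever one of its right factors depends
   linearly on the others; otherwise a dual form isolates the left factor. *)
Lemma tens_in_submodule (I : A -> Prop) (z : tens A B) : subspace I ->
  (forall l, I (tevr l z)) ->
  exists2 s : seq (A * B), z = \sum_(p <- s) pure p.1 p.2
    & forall p, p \in s -> I p.1.
Proof.
move=> Isub; have [n [a [b ->]]] := tens_seqE z => {z}.
elim: n => [|n IHn] in a b *.
  by exists [::]; rewrite ?big_ord0 ?big_nil.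
pose W (x : B) := exists c : 'I_n -> k, x = \sum_i calg_in B (c i) * b (lift ord0 i).
have [[c cE]|nW] := pselect (W (b ord0)).
  have -> : \sum_i pure (a i) (b i) =
      \sum_(i < n) pure (calg_in A (c i) * a ord0 + a (lift ord0 i)) (b (lift ord0 i)).
    rewrite big_ord_recl cE; under [RHS]eq_bigr do rewrite pureDl pure_bal.
    rewrite big_split /=; congr (_ + _).
    exact: (big_morph (pure (a ord0)) (pureDr (a ord0)) (pure0r _ (a ord0))).
  exact: IHn.
have Wsub : subspace W.
  split; first by exists (fun=> 0); rewrite big1 // => i _; rewrite rmorph0 mul0r.
    move=> _ _ [c ->] [c' ->]; exists (fun i => c i + c' i).
    by rewrite -big_split; apply: eq_bigr => i _ /=; rewrite rmorphD mulrDl.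
  move=> e _ [c ->]; exists (fun i => e * c i).
  by rewrite mulr_sumr; apply: eq_bigr => i _; rewrite rmorphM mulrA.
have [l0 [l0b l0W]] := exists_linform Wsub nW.
move=> Iev; case: (Isub) => I0 ID IZ.
have Ia0 : I (a ord0).
  have := Iev l0; rewrite raddf_sum big_ord_recl /= tevr_pure l0b rmorph1 mulr1.
  rewrite big1 ?addr0 // => i _; rewrite tevr_pure l0W ?rmorph0 ?mulr0 //.
  exists (fun j => (j == i)%:R); rewrite (bigD1 i) //= eqxx rmorph1 mul1r big1 ?addr0 //.
  by move=> j /negPf->; rewrite rmorph0 mul0r.
have [|s sE sI] := IHn (a \o lift ord0) (b \o lift ord0).
  move=> l; have := Iev l; rewrite big_ord_recl raddfD /= tevr_pure => h.
  rewrite -[tevr _ _](addKr (a ord0 * calg_in A (l (b ord0)))); apply: (ID) h.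
  by apply: (subspaceN Isub); rewrite mulrC; apply: IZ.
exists ((a ord0, b ord0) :: s); first by rewrite big_cons /= big_ord_recl -sE.
by move=> p; rewrite inE => /orP[/eqP->|/sI].
Qed.

Lemma subspace0 : subspace (fun x : A => x = 0).
Proof. by split=> // [x y -> ->|c x ->]; rewrite ?addr0 ?mulr0. Qed.

(** This is [tens_in_submodule] for the zero submodule. Identities in [tens A B] can thus be tested
    in [A]. *)
Lemma tens_eq0 (z : tens A B) : (forall l, tevr l z = 0) -> z = 0.
Proof.
move=> /(tens_in_submodule subspace0)[s -> s0].
by rewrite big_seq big1 // => p /s0->; rewrite pure0l.
Qed.

End Evaluation.

Lemma tevr_tmap (k : fieldType) (A A' B : calg k) (u : ahom A A') (l : linform B) z :
  tevr l (tmap u (ahom_id B) z) = u (tevr l z).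
Proof.
move: z; elim/tens_ind => [|x y hx hy|a b]; first by rewrite !raddf0.
  by rewrite !raddfD /= hx hy.
by rewrite tmap_pure !tevr_pure rmorphM ahomP.
Qed.

(** * Scalar coefficients of a higher derivation *)

Section Coefficients.
Variables (F : fieldType) (Om : galg F) (S : calg F).
Variable th : {rmorphism S -> cpl (bc S Om)}.

(** This is (id (x) l) o th^(k), an operator on [S] itself. Letting [l] run over all forms loses
    nothing, by [tens_eq0]. *)
Definition hdcoef k (l : linform Om) (r : S) : S := tevr l (th r k).

Fact hdcoef_zmod k l : zmod_morphism (hdcoef k l).
Proof. by move=> x y; rewrite /hdcoef rmorphB -[LHS]/(tevr l (th x k - th y k)) raddfB. Qed.
HB.instance Definition _ k l :=
  GRing.isZmodMorphism.Build S S (hdcoef k l) (hdcoef_zmod k l).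

Lemma cinM (c : S) (z : cpl (bc S Om)) k : (cin (bc S Om) c * z) k = tinl Om c * z k.
Proof.
rewrite -[LHS]/(\sum_(i < k.+1) (cin (bc S Om) c) i * z (k - i)%N).
rewrite big_ord_recl subn0 big1 ?addr0 => [|i _]; last by rewrite mul0r.
by rewrite -[cin _ c _]/(gproj (g := bc S Om) 0 (calg_in (bc S Om) c)) gproj_in.
Qed.

(** For a constant [c], multiplicativity of [th] gives th(c r) = c th(r), and contractions are
    linear in the left factor. *)
Lemma hdcoefM k l c r : th c = cin (bc S Om) c -> hdcoef k l (c * r) = c * hdcoef k l r.
Proof. by move=> cc; rewrite /hdcoef rmorphM cc cinM tevr_inlM. Qed.

Lemma hdcoef_cst k l c : (0 < k)%N -> th c = cin (bc S Om) c -> hdcoef k l c = 0.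
Proof. by case: k => // k _ cc; rewrite /hdcoef cc raddf0. Qed.

Lemma cst_hdcoef c : th c 0%N = calg_in (bc S Om) c ->
  (forall k l, (0 < k)%N -> hdcoef k l c = 0) -> th c = cin (bc S Om) c.
Proof.
move=> c0 cP; apply: cplP => -[|k].
  by rewrite c0 -[RHS]/(gproj (g := bc S Om) 0 (calg_in (bc S Om) c)) gproj_in.
by apply: tens_eq0 => l; apply: cP.
Qed.
End Coefficients.

Lemma hdcoef_nat (F : fieldType) (Om : galg F) (S S' : calg F)
    (th : {rmorphism S -> cpl (bc S Om)}) (th' : {rmorphism S' -> cpl (bc S' Om)})
    (u : ahom S S') k (l : linform Om) r :
  th' (u r) = cbc Om u (th r) -> hdcoef th' k l (u r) = u (hdcoef th k l r).
Proof. by move=> ur; rewrite /hdcoef ur cbcE tevr_tmap. Qed.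

(** * Theta-ideals, and constants after extension of scalars *)

Section ThetaIdeals.
Variables (K F : fieldType) (iK : {rmorphism K -> F}) (Om : galg F) (theta : hder iK Om).
Variable R : thring theta.

(** The [hdcoef k l] are the contractions of the degree [k] component, so [tens_in_submodule]
    provides left factors in [I]. *)
Lemma theta_idealP (I : R -> Prop) :
  I 0 -> (forall x y, I x -> I y -> I (x + y)) -> (forall r x, I x -> I (r * x)) ->
  (forall k l x, I x -> I (hdcoef (tr_hd R) k l x)) -> theta_ideal I.
Proof.
move=> I0 ID IM Ihd; split=> // k x Ix.
have Isub : subspace I by split=> // c y; apply: IM.
have [s sE sI] := tens_in_submodule Isub (fun l => Ihd k l x Ix).
(* The right factors must be homogeneous; projecting them to degree [k] keeps the sum, which already
   has degree [k]. *)
exists [seq (p.1, gproj k p.2) | p <- s].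
  rewrite big_map -(cvalP (tr_hd R x) k) sE raddf_sum /=.
  by apply: eq_bigr => p _; apply: bc_gproj_pure.
by move=> _ /mapP[p ps ->] /=; rewrite gproj_proj eqxx; split=> //; apply: sI.
Qed.

Hypotheses (R_simple : theta_simple R) (R_const : const_base (tr_hd R)).

(** A K-linear splitting of K -> R exists because 1 is non-zero. Applied to the left factor, it
    recovers [L] from [R_L]. *)
Lemma exists_retraction : exists e : linform (RK R), e 1 = 1.
Proof.
have [|e [e1 _]] := @exists_linform K (RK R) (fun x => x = 0) 1 (subspace0 _).
  by case: R_simple.
by exists e.
Qed.

Section ScalarExtension.
Variable L : calg K.

Lemma ext_hdcoef k (l : linform Om) (r : R) (a : L) :
  hdcoef (ext_hd R L) k l (@pure _ (RK R) L r a) =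
  @pure _ (RK R) L (hdcoef (tr_hd R) k l r) a.
Proof.
rewrite pureE mulrC hdcoefM; last exact: ext_hd_inr.
rewrite (hdcoef_nat (u := inRL R L) (th := tr_hd R)); last exact: ext_hd_inl.
by rewrite mulrC [RHS]pureE.
Qed.

(** Values of forms on [L] lie in [K], hence are constant. This reduces constants of [R_L] to
    constants of [R]. *)
Lemma hdcoef_tevr k (l : linform Om) (m : linform L) (x : RL R L) :
  hdcoef (tr_hd R) k l (@tevr _ (RK R) L m x) =
  @tevr _ (RK R) L m (hdcoef (ext_hd R L) k l x).
Proof.
move: x; elim/tens_ind => [|x y hx hy|r a]; first by rewrite !raddf0.
  by rewrite !raddfD /= hx hy.
rewrite ext_hdcoef !tevr_pure mulrC hdcoefM; first by rewrite mulrC.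
exact: (hdK (tr_hd R)).
Qed.

(* If e is a form on R with e 1 = 1, then x - 1 (x) (e (x) id) x is killed by
   every form on L, since these map x to constants of R. *)
Lemma ext_cst (x : RL R L) :
  (forall k l, (0 < k)%N -> hdcoef (ext_hd R L) k l x = 0) ->
  exists a : L, x = @tinr _ (RK R) L a.
Proof.
move=> xcst; have [e e1] := exists_retraction.
exists (@tevl _ (RK R) L e x).
apply/subr0_eq/tens_eq0 => m; rewrite raddfB /=.
have [c xc] : exists c, @tevr _ (RK R) L m x = calg_in (RK R) c.
  apply/R_const/asboolP/cst_hdcoef; first exact: hd0.
  by move=> k l k0; rewrite hdcoef_tevr xcst // raddf0.
rewrite /tinr tevr_pure mul1r.
(* Both sides are (e (x) m)(x). *)
suff -> : m (@tevl _ (RK R) L e x) = e (@tevr _ (RK R) L m x).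
  by rewrite xc -{2}[calg_in _ c]mulr1 lfZ e1 mulr1 subrr.
move: (x); elim/tens_ind => [|y z hy hz|r a]; first by rewrite !raddf0 !lf0.
  by rewrite !raddfD /= !lfD hy hz.
by rewrite tevr_pure tevl_pure lfZ [r * _]mulrC lfZ mulrC.
Qed.

Lemma tinrRL_inj : injective (@tinr _ (RK R) L).
Proof.
have [e e1] := exists_retraction.
move=> a b /(congr1 (@tevl _ (RK R) L e)).
by rewrite !tevl_pure e1 rmorph1 !mul1r.
Qed.

End ScalarExtension.
End ThetaIdeals.

Lemma pureBl (S : comPzRingType) (A B : calg S) (a a' : A) (b : B) :
  pure (a - a') b = pure a b - pure a' b.
Proof. by apply: (addIr (pure a' b)); rewrite -pureDl !subrK. Qed.

(** * The natural map R (x)_K U -> T: injectivity, and spanning by constants *)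

Section TensorSquare.
Variables (K F : fieldType) (iK : {rmorphism K -> F}) (Om : galg F) (theta : hder iK Om).
Variable R : thring theta.

Local Notation T := (tens_calg R R).
Local Notation thT := (hder_tens R R).
Local Notation U := (const_alg thT).
Local Notation inl := (@tinl F R R).
Local Notation inr := (@tinr F R R).

Definition cinc : {rmorphism U -> T} := \val.

Lemma cinc_inj : injective cinc.
Proof. exact: val_inj. Qed.

Lemma cstP (u : U) : thT (cinc u) = cin (bc T Om) (cinc u).
Proof. by apply/asboolP; apply: cst_valP u. Qed.

Lemma thT_inl r : thT (inl r) = cbc Om (ahom_inl R R) (tr_hd R r).
Proof. exact: tpush_inl. Qed.

Lemma thT_inr r : thT (inr r) = cbc Om (ahom_inr R R) (tr_hd R r).
Proof. exact: tpush_inr. Qed.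

Let tcst_u : {rmorphism RK R -> T} := inl : {rmorphism R -> tens R R}.

Fact tcst_subproof c : tcst_u (calg_in (RK R) c) = cinc (calg_in U c).
Proof. by []. Qed.

(* r (x) u |-> (r (x) 1) u *)
Definition tcst_fun : {rmorphism RL R U -> T} := tpush tcst_subproof.

Lemma tcst_pure r u : tcst_fun (@pure _ (RK R) U r u) = inl r * cinc u.
Proof. exact: (tpush_pure tcst_subproof). Qed.
Lemma tcst_inl r : tcst_fun (@tinl _ (RK R) U r) = inl r.
Proof. exact: (tpush_inl tcst_subproof). Qed.
Lemma tcst_inr u : tcst_fun (@tinr _ (RK R) U u) = cinc u.
Proof. exact: (tpush_inr tcst_subproof). Qed.

Fact tcst_subproof2 t : tcst_fun (calg_in (RLF R U) t) = calg_in T t.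
Proof. by rewrite -[calg_in _ t]RL_inl tcst_inl. Qed.
Definition tcst : ahom (RLF R U) T := @AHom F (RLF R U) T tcst_fun tcst_subproof2.

Lemma tcst_theta w : thT (tcst w) = cbc Om tcst (ext_hd R U w).
Proof.
(* Bundled as ring morphisms, the two sides can be compared on the generators of [RL R U]. *)
pose f : {rmorphism RL R U -> cpl (bc T Om)} := thT \o tcst.
pose g : {rmorphism RL R U -> cpl (bc T Om)} := cbc Om tcst \o ext_hd R U.
rewrite -[LHS]/(f w) -[RHS]/(g w); apply: RL_ext => {}w.
  rewrite -[LHS]/(thT (tcst_fun _)) -[RHS]/(cbc Om tcst (ext_hd R U _)).
  rewrite tcst_inl ext_hd_inl thT_inl.
  by symmetry; apply: cbc_comp => r; symmetry; apply: tcst_inl.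
rewrite -[LHS]/(thT (tcst_fun _)) -[RHS]/(cbc Om tcst (ext_hd R U _)).
rewrite tcst_inr ext_hd_inr cstP cbc_cin.
by congr cin; symmetry; apply: tcst_inr.
Qed.

Hypotheses (R_simple : theta_simple R) (R_const : const_base (tr_hd R)).

Lemma hdcoef_inlM k l r (u : U) :
  hdcoef thT k l (inl r * cinc u) = inl (hdcoef (tr_hd R) k l r) * cinc u.
Proof.
rewrite mulrC hdcoefM ?cstP // mulrC.
by rewrite (hdcoef_nat (u := ahom_inl R R) (th := tr_hd R)) // thT_inl.
Qed.

Lemma hdcoef_comb k l n (s : 'I_n -> R) (u : 'I_n -> U) :
  hdcoef thT k l (\sum_i inl (s i) * cinc (u i)) =
  \sum_i inl (hdcoef (tr_hd R) k l (s i)) * cinc (u i).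
Proof.
rewrite (raddf_sum (hdcoef thT k l)); apply: eq_bigr => i _; exact: hdcoef_inlM.
Qed.

(* By induction on the number of terms.  The possible coefficients r0 form a
   theta-ideal; if it is everything, a relation u0 + s1 u1 + ... + sn un = 0
   can be differentiated, so w = sum si (x) ui is constant by induction, hence
   of the form 1 (x) v with v = - u0, and u0 can be eliminated. *)
Lemma cst_disjoint n (r : 'I_n -> R) (u : 'I_n -> U) :
  \sum_i inl (r i) * cinc (u i) = 0 -> \sum_i @pure _ (RK R) U (r i) (u i) = 0.
Proof.
elim: n => [|n IHn] in r u *; first by rewrite !big_ord0.
pose I (x : R) := exists s : 'I_n -> R,
  inl x * cinc (u ord0) + \sum_i inl (s i) * cinc (u (lift ord0 i)) = 0.
have Iid : theta_ideal I.
  apply: theta_idealP.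
  - by exists (fun=> 0); rewrite big1 => [|i _]; rewrite rmorph0 mul0r ?addr0.
  - move=> x y [s xE] [t yE]; exists (fun i => s i + t i).
    rewrite rmorphD mulrDl; under eq_bigr do rewrite rmorphD mulrDl.
    by rewrite big_split addrACA xE yE addr0.
  - move=> a x [s xE]; exists (fun i => a * s i).
    under eq_bigr do rewrite rmorphM -mulrA.
    by rewrite rmorphM -mulrA -mulr_sumr -mulrDr xE mulr0.
  - move=> k l x [s xE]; exists (fun i => hdcoef (tr_hd R) k l (s i)).
    have := congr1 (hdcoef thT k l) xE.
    by rewrite raddf0 raddfD /= hdcoef_inlM hdcoef_comb.
have [_ /(_ I Iid)[I0|IT]] := R_simple.
  (* If [I] is zero, the leading coefficient vanishes and the relation is shorter. *)
  rewrite !big_ord_recl => rE.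
  have r0 : r ord0 = 0 by apply: I0; exists (fun i => r (lift ord0 i)).
  move: rE; rewrite r0 rmorph0 mul0r add0r pure0l add0r.
  exact: (IHn (fun i => r (lift ord0 i))).
have [s] := IT 1; rewrite rmorph1 mul1r => sE.
pose w : RL R U := \sum_i @pure _ (RK R) U (s i) (u (lift ord0 i)).
have wE : tcst w = - cinc (u ord0).
  rewrite raddf_sum /=; under eq_bigr do rewrite tcst_pure.
  by apply/eqP; rewrite -addr_eq0 addrC sE.
have [|v vE] := ext_cst R_simple R_const (x := w).
  move=> k l k0; rewrite raddf_sum /=; under eq_bigr do rewrite ext_hdcoef.
  apply: IHn; have := congr1 (hdcoef thT k l) sE.
  by rewrite raddf0 raddfD /= (hdcoef_cst _ k0) ?cstP // add0r hdcoef_comb.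
have vu : v = - u ord0.
  by apply: cinc_inj; rewrite raddfN /= -wE vE; symmetry; apply: tcst_inr.
have u0E : @tinr _ (RK R) U (u ord0) = - w by rewrite vE vu raddfN opprK.
rewrite big_ord_recl => rE.
(* These coefficients remain after replacing 1 (x) u0 by - w. *)
pose r' i := r (lift ord0 i) - r ord0 * s i.
have e1 : \sum_i @pure _ (RK R) U (r i) (u i) =
          \sum_i @pure _ (RK R) U (r' i) (u (lift ord0 i)).
  rewrite big_ord_recl pureE u0E mulrN mulr_sumr addrC -sumrB.
  by apply: eq_bigr => i _; rewrite /tinl pureM mul1r pureBl.
rewrite e1; apply: IHn.
under eq_bigr do rewrite rmorphB mulrBl rmorphM -mulrA.
rewrite sumrB -mulr_sumr; move/eqP: sE; rewrite addrC addr_eq0 => /eqP->.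
by rewrite mulrN opprK addrC.
Qed.

Lemma tcst_inj : injective tcst.
Proof.
move=> x y /eqP; rewrite -subr_eq0 -raddfB => /eqP xy; apply: subr0_eq; move: xy.
have [n [r [u ->]]] := tens_seqE (x - y : tens (RK R) U).
rewrite raddf_sum /=; under eq_bigr do rewrite tcst_pure.
exact: cst_disjoint.
Qed.

(** The predicate [P] lets one argument serve twice: a subalgebra containing the generators yields
    finite generation, and the full predicate yields surjectivity of [tcst]. *)
Definition cst_span (P : U -> Prop) (t : T) :=
  exists2 s : seq (R * U), t = \sum_(p <- s) inl p.1 * cinc p.2
    & forall p, p \in s -> P p.2.

Section Span.
Variables (P : U -> Prop) (Psub : subalg P).

Lemma cst_span0 : cst_span P 0.
Proof. by exists [::]; rewrite ?big_nil. Qed.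

Lemma cst_span1 r u : P u -> cst_span P (inl r * cinc u).
Proof. by exists [:: (r, u)]; rewrite ?big_seq1 // => p; rewrite inE => /eqP->. Qed.

Lemma cst_spanD t t' : cst_span P t -> cst_span P t' -> cst_span P (t + t').
Proof.
move=> [s -> sP] [s' -> s'P]; exists (s ++ s'); first by rewrite big_cat.
by move=> p; rewrite mem_cat => /orP[/sP|/s'P].
Qed.

Lemma cst_span_sum I (r : seq I) (t : I -> T) :
  (forall i, cst_span P (t i)) -> cst_span P (\sum_(i <- r) t i).
Proof. by move=> tP; elim/big_ind: _; [exact: cst_span0|exact: cst_spanD|]. Qed.

Lemma cst_spanM t t' : cst_span P t -> cst_span P t' -> cst_span P (t * t').
Proof.
case: Psub => _ _ PM [s -> sP] [s' -> s'P].
rewrite mulr_suml big_seq; elim/big_rec: _ => [|p y ps yP]; first exact: cst_span0.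
apply: cst_spanD yP; rewrite mulr_sumr big_seq.
elim/big_rec: _ => [|q z qs zP]; first exact: cst_span0.
apply: cst_spanD zP; rewrite mulrACA -!rmorphM; apply: cst_span1.
by apply: PM; [exact: sP|exact: s'P].
Qed.

Lemma cst_span_inl r : cst_span P (inl r).
Proof.
rewrite -[inl r]mulr1 -[1](rmorph1 (cinc : U -> T)); apply: cst_span1.
by case: Psub => /(_ 1); rewrite rmorph1.
Qed.

End Span.

(** Applying [thT] to [c * e = 1] shows that [thT e] and [cin _ e] are both inverse to [cin _ c]. *)
Lemma cst_inv (c e : T) : thT c = cin (bc T Om) c -> c * e = 1 ->
  thT e = cin (bc T Om) e.
Proof.
move=> cc ce.
have /(congr1 ( *%R (thT e))) : thT c * cin (bc T Om) e = 1 by rewrite cc -rmorphM ce rmorph1.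
by rewrite mulr1 mulrA -rmorphM [e * c]mulrC ce rmorph1 mul1r.
Qed.

(* The witness s lists the entries of Z = (Y^-1 (x) 1)(1 (x) Y) and the inverse of det Z. *)
Lemma PPV_cst_span n (A : 'M_n) : inGL A -> PPV_for A R ->
  exists s : seq U, forall P : U -> Prop, subalg P -> (forall u, u \in s -> P u) ->
  forall t, cst_span P t.
Proof.
move=> [A' [_ A'A]] [_ [Y [d [[Y' [YY' Y'Y]] thY dY Rgen]]] _].
have [Z YZ] : exists Z : 'M[T]_n, map_mx inl Y *m Z = map_mx inr Y.
  by exists (map_mx inl Y' *m map_mx inr Y); rewrite mulmxA -map_mxM YY' map_mx1 mul1mx.
(* Both images of [Y] in [T] solve theta(y) = A y, since the entries of [A] have the same image
   along either inclusion. *)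
have th_in (u : ahom R T) : (forall r, thT (u r) = cbc Om u (tr_hd R r)) ->
    map_mx thT (map_mx u Y) = map_mx (cbc_in T) A *m map_mx (cin (bc T Om)) (map_mx u Y).
  move=> thu; transitivity (map_mx (cbc Om u) (map_mx (tr_hd R) Y)).
    by apply/matrixP=> i j; rewrite !mxE thu.
  rewrite thY map_mxM; congr (_ *m _); apply/matrixP=> i j; rewrite !mxE.
    exact: cbc_in_nat.
  exact: cbc_cin.
(* With Y1 = Y (x) 1, applying [thT] to [YZ] gives A Y1 theta(Z) = A Y1 Z; [A'] and [Y'] then cancel
   A and Y1. *)
have Zcst : map_mx thT Z = map_mx (cin (bc T Om)) Z.
  have := congr1 (map_mx thT) YZ.
  rewrite map_mxM [map_mx thT _](th_in (ahom_inl R R) thT_inl).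
  rewrite [map_mx thT (map_mx inr Y)](th_in (ahom_inr R R) thT_inr).
  rewrite -[map_mx (ahom_inr R R) Y]/(map_mx inr Y) -YZ map_mxM -!mulmxA.
  rewrite -[map_mx (ahom_inl R R) Y]/(map_mx inl Y).
  move=> /(congr1 (mulmx (map_mx (cbc_in T) A'))); rewrite !mulmxA -map_mxM A'A map_mx1 !mul1mx.
  move=> /(congr1 (mulmx (map_mx (cin (bc T Om)) (map_mx inl Y')))).
  by rewrite !mulmxA -!map_mxM Y'Y !map_mx1 !mul1mx.
have Zc i j : Z i j \in is_const thT.
  by apply/asboolP; move/matrixP/(_ i j): Zcst; rewrite !mxE.
(* det Z is (det Y)^-1 (x) det Y, so its inverse is det Y (x) d. *)
have detZ : \det Z * (inl (\det Y) * inr d) = 1.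
  have e : inl (\det Y) * \det Z = inr (\det Y).
    by rewrite -(det_map_mx inl) -(det_map_mx inr) -det_mulmx YZ.
  by rewrite mulrA [\det Z * _]mulrC e -rmorphM dY rmorph1.
have ec : inl (\det Y) * inr d \in is_const thT.
  by apply/asboolP/(cst_inv _ detZ); rewrite -!det_map_mx Zcst.
exists ((Cst ec : U) :: [seq (Cst (Zc p.1 p.2) : U) | p : 'I_n * 'I_n]) => P Psub sP.
(* The [r] with 1 (x) r in the span form an F-subalgebra, so only the generators of [R] need
   checking. *)
have inrP r : cst_span P (inr r).
  apply: (Rgen (fun r => cst_span P (inr r))) => [|{}r].
    split=> [c|x y|x y]; first by rewrite -tin_bal; apply: cst_span_inl.
      by rewrite rmorphD; apply: cst_spanD.
    by rewrite rmorphM; apply: cst_spanM.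
  case=> [[i [j ->]]|->].
    move/matrixP/(_ i j): YZ; rewrite !mxE => <-; apply: cst_span_sum => k.
    rewrite mxE; apply: (@cst_span1 P (Y i k) (Cst (Zc k j))).
    apply: sP; rewrite in_cons; apply/orP; right.
    by apply/mapP; exists (k, j); rewrite ?mem_enum.
  have -> : inr d = inl d * (inl (\det Y) * inr d).
    by rewrite mulrA -rmorphM mulrC [d * _]mulrC dY rmorph1 mulr1.
  by apply: (@cst_span1 P d (Cst ec)); apply: sP; apply: mem_head.
elim/tens_ind => [|x y|a b]; [exact: cst_span0|exact: cst_spanD|rewrite pureE].
by apply: cst_spanM => //; apply: cst_span_inl.
Qed.

End TensorSquare.

(** * Inverses of bijective algebra morphisms *)

Section InverseMorphism.
Variables (S : comPzRingType) (A B : calg S) (u : ahom A B) (v : B -> A).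
Hypotheses (uK : cancel u v) (vK : cancel v u).

Let v_zmod : zmod_morphism v.
Proof. by move=> x y; apply: (can_inj uK); rewrite rmorphB !vK. Qed.
Let v_monoid : monoid_morphism v.
Proof. by split=> [|x y]; apply: (can_inj uK); rewrite (rmorph1, rmorphM) !vK. Qed.
HB.instance Definition _ := GRing.isZmodMorphism.Build B A v v_zmod.
HB.instance Definition _ := GRing.isMonoidMorphism.Build B A v v_monoid.
Let vP s : v (calg_in B s) = calg_in A s.
Proof. by apply: (can_inj uK); rewrite vK ahomP. Qed.

Lemma ahom_inv : exists w : ahom B A, w =1 v.
Proof. by exists (@AHom S B A v vP). Qed.
End InverseMorphism.

(** * The exchange of the factors of [T] and the antipode of [U] *)

Section Representation.
Variables (K F : fieldType) (iK : {rmorphism K -> F}) (Om : galg F) (theta : hder iK Om).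
Variable R : thring theta.

Local Notation T := (tens_calg R R).
Local Notation thT := (hder_tens R R).
Local Notation U := (const_alg thT).
Local Notation inl := (@tinl F R R).
Local Notation inr := (@tinr F R R).
Local Notation cinc := (cinc R).

Section Swap.

Let swap_u : {rmorphism R -> T} := inr.
Let swap_v : {rmorphism R -> T} := inl.
Fact swap_subproof s : swap_u (calg_in R s) = swap_v (calg_in R s).
Proof. by symmetry; apply: tin_bal. Qed.
Definition swap_fun : {rmorphism T -> T} := tpush swap_subproof.

Lemma swap_inl r : swap_fun (inl r) = inr r.
Proof. exact: (tpush_inl swap_subproof). Qed.
Lemma swap_inr r : swap_fun (inr r) = inl r.
Proof. exact: (tpush_inr swap_subproof). Qed.

Fact swap_subproof2 s : swap_fun (calg_in T s) = calg_in T s.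
Proof. by rewrite -[calg_in T s]/(inl (calg_in R s)) swap_inl -tin_bal. Qed.
Definition swap : ahom T T := @AHom F T T swap_fun swap_subproof2.

Lemma swap_theta t : thT (swap t) = cbc Om swap (thT t).
Proof.
pose f : {rmorphism T -> cpl (bc T Om)} := thT \o swap.
pose g : {rmorphism T -> cpl (bc T Om)} := cbc Om swap \o thT.
rewrite -[LHS]/(f t) -[RHS]/(g t); apply: tens_rext => {}t.
  rewrite -[LHS]/(thT (swap_fun (inl t))) -[RHS]/(cbc Om swap (thT (inl t))).
  rewrite swap_inl thT_inl thT_inr; symmetry; apply: cbc_comp => r.
  by symmetry; apply: swap_inl.
rewrite -[LHS]/(thT (swap_fun (inr t))) -[RHS]/(cbc Om swap (thT (inr t))).
rewrite swap_inr thT_inl thT_inr; symmetry; apply: cbc_comp => r.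
by symmetry; apply: swap_inr.
Qed.

Lemma swapK : involutive swap.
Proof.
pose f : {rmorphism T -> T} := swap \o swap.
move=> t; rewrite -[LHS]/(f t) -[RHS]/((idfun : {rmorphism T -> T}) t).
apply: tens_rext => {}t /=; rewrite -[LHS]/(swap_fun (swap_fun _)).
  by rewrite swap_inl swap_inr.
by rewrite swap_inr swap_inl.
Qed.

Fact swap_cst (u : U) : swap (cinc u) \in is_const thT.
Proof. by apply/asboolP; rewrite swap_theta cstP cbc_cin. Qed.
(** The exchange commutes with theta, hence preserves constants; on points of [U] it will yield the
    inverse automorphism. *)
Definition antipode_fun (u : U) : U := Cst (swap_cst u).

Lemma antipodeE u : cinc (antipode_fun u) = swap (cinc u).
Proof. by []. Qed.

Fact antipode_zmod : zmod_morphism antipode_fun.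
Proof. by move=> x y; apply: cinc_inj; rewrite rmorphB !antipodeE !rmorphB. Qed.
Fact antipode_monoid : monoid_morphism antipode_fun.
Proof.
split=> [|x y]; apply: cinc_inj; first by rewrite antipodeE !rmorph1.
by rewrite [RHS]rmorphM !antipodeE !rmorphM.
Qed.
HB.instance Definition _ := GRing.isZmodMorphism.Build U U antipode_fun antipode_zmod.
HB.instance Definition _ := GRing.isMonoidMorphism.Build U U antipode_fun antipode_monoid.

Fact antipode_subproof c : antipode_fun (calg_in U c) = calg_in U c.
Proof. by apply: cinc_inj; rewrite antipodeE; apply: (ahomP swap). Qed.
Definition antipode : ahom U U := @AHom K U U antipode_fun antipode_subproof.

End Swap.

(** * Finite generation of [U], and the identification T = R (x)_K U *)

Hypotheses (R_simple : theta_simple R) (R_const : const_base (tr_hd R)).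
Variable gens : seq U.
Hypothesis gensP : forall P : U -> Prop, subalg P -> (forall u, u \in gens -> P u) ->
  forall t, cst_span P t.

(** Write u = sum r_i u_i in [T] with the u_i in the subalgebra [P]. Injectivity of [tcst] lifts
    this to 1 (x) u = sum r_i (x) u_i, and a retraction [e] gives u = sum e(r_i) u_i, which lies in
    [P]. *)
Lemma cst_fin_gen : fin_gen U.
Proof.
exists gens => P Psub /(gensP Psub) spanP u.
have [s uE sP] := spanP (cinc u).
have [e e1] := exists_retraction R_simple.
have uT : @tinr _ (RK R) U u = \sum_(p <- s) @pure _ (RK R) U p.1 p.2.
  apply: (tcst_inj R_simple R_const); rewrite (raddf_sum (tcst R)).
  rewrite [LHS](tcst_inr u) uE; apply: eq_bigr => p _; symmetry; exact: tcst_pure.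
have := congr1 (@tevl _ (RK R) U e) uT.
rewrite raddf_sum /tinr tevl_pure e1 rmorph1 mul1r => ->.
case: Psub => PK PD PM; rewrite big_seq.
elim/big_ind: _ => [|//|p ps]; first by rewrite -(rmorph0 (calg_in U)); apply: PK.
by rewrite /= tevl_pure; apply: PM; [exact: PK|exact: sP].
Qed.

Lemma tcst_surj t : exists w, tcst R w = t.
Proof.
have [|//|s -> _] := gensP (P := fun=> True) _ _ t; first by split.
exists (\sum_(p <- s) @pure _ (RK R) U p.1 p.2).
by rewrite (raddf_sum (tcst R)); apply: eq_bigr => p _; apply: tcst_pure.
Qed.

Lemma exists_split : exists d : ahom T (RLF R U), cancel d (tcst R) /\ cancel (tcst R) d.
Proof.
have [v vK] := choice tcst_surj.
have Kv : cancel (tcst R) v by move=> w; apply: (tcst_inj R_simple R_const).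
by have [d dv] := ahom_inv Kv vK; exists d; split=> x; rewrite dv.
Qed.

Definition csplit : ahom T (RLF R U) := projT1 (cid exists_split).
Lemma csplitK : cancel csplit (tcst R). Proof. by case: (projT2 (cid exists_split)). Qed.
Lemma tcstK : cancel (tcst R) csplit. Proof. by case: (projT2 (cid exists_split)). Qed.

Lemma csplit_inl r : csplit (inl r) = @tinl _ (RK R) U r.
Proof. by rewrite -tcst_inl; apply: tcstK. Qed.
Lemma csplit_cinc u : csplit (cinc u) = @tinr _ (RK R) U u.
Proof. by rewrite -tcst_inr; apply: tcstK. Qed.

Lemma csplit_theta t : ext_hd R U (csplit t) = cbc Om csplit (thT t).
Proof.
rewrite -{2}(csplitK t) tcst_theta.
rewrite (cbc_comp (w := ahom_id _)) ?cbc_id // => w.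
by symmetry; apply: tcstK.
Qed.

(** Transport along T = R (x)_K U. Morphisms from [T] can thus be compared either on the two copies
    of [R] or on R (x) 1 and [U]; later proofs pass from one to the other. *)
Lemma T_ext (C : comPzRingType) (f g : {rmorphism T -> C}) :
  (forall r, f (inl r) = g (inl r)) -> (forall u, f (cinc u) = g (cinc u)) -> f =1 g.
Proof.
move=> fg1 fg2 t; rewrite -(csplitK t).
pose f' : {rmorphism RL R U -> C} := f \o tcst R.
pose g' : {rmorphism RL R U -> C} := g \o tcst R.
rewrite -[LHS]/(f' _) -[RHS]/(g' _); apply: RL_ext => x.
  by rewrite -[LHS]/(f (tcst_fun R _)) -[RHS]/(g (tcst_fun R _)) tcst_inl.
by rewrite -[LHS]/(f (tcst_fun R _)) -[RHS]/(g (tcst_fun R _)) tcst_inr.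
Qed.

(** * The endomorphism of [R_L] attached to a point U -> L *)

Section Point.
Variables (L : calg K) (p : ahom U L).

(* r (x) 1 |-> r (x) 1 and u |-> 1 (x) p(u) *)
Definition spec : ahom T (RLF R L) := ahom_comp (RL_mapF R p) csplit.

Lemma spec_inl r : spec (inl r) = @tinl _ (RK R) L r.
Proof. by rewrite -[LHS]/(RL_map R p (csplit _)) csplit_inl RL_map_inl. Qed.
Lemma spec_cinc u : spec (cinc u) = @tinr _ (RK R) L (p u).
Proof. by rewrite -[LHS]/(RL_map R p (csplit _)) csplit_cinc RL_map_inr. Qed.

Lemma spec_theta t : ext_hd R L (spec t) = cbc Om spec (thT t).
Proof.
rewrite -[spec t]/(RL_map R p (csplit t)) ext_hd_nat csplit_theta.
exact: cbc_comp.
Qed.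

Let act_u : {rmorphism RK R -> RL R L} := spec \o (inr : {rmorphism R -> tens R R}).
Let act_v : {rmorphism L -> RL R L} := @tinr _ (RK R) L : {rmorphism L -> tens (RK R) L}.

Fact act_subproof c : act_u (calg_in (RK R) c) = act_v (calg_in L c).
Proof.
rewrite -[LHS]/(spec (inr (calg_in R (iK c)))) -tin_bal spec_inl.
exact: (@tin_bal K (RK R) L).
Qed.
(** This is the L-linear extension of the coaction R -> T = R (x)_K U, r |-> 1 (x) r, followed by id
    (x) p. *)
Definition act_fun : {rmorphism RL R L -> RL R L} := tpush act_subproof.

Lemma act_inl r : act_fun (@tinl _ (RK R) L r) = spec (inr r).
Proof. exact: (tpush_inl act_subproof). Qed.
Lemma act_inr a : act_fun (@tinr _ (RK R) L a) = @tinr _ (RK R) L a.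
Proof. exact: (tpush_inr act_subproof). Qed.

Fact actP x : act_fun (calg_in (RL R L) x) = calg_in (RL R L) x.
Proof.
pose g : {rmorphism tens (FK iK) L -> RL R L} := act_fun \o calg_in (RL R L).
rewrite -[LHS]/(g x); move: x; apply: tens_rext => x.
  rewrite -[LHS]/(act_fun (calg_in (RL R L) _)) -RL_inl act_inl.
  by rewrite -tin_bal spec_inl.
by rewrite -[LHS]/(act_fun (calg_in (RL R L) _)) -RL_inr act_inr.
Qed.
Definition act : ahom (RL R L) (RL R L) := AHom actP.

Lemma act_comm : commutes_theta act.
Proof.
move=> y.
pose g : {rmorphism RL R L -> cpl (bc (RLF R L) Om)} := ext_hd R L \o act_fun.
pose h : {rmorphism RL R L -> cpl (bc (RLF R L) Om)} := cbc Om (ahomF act) \o ext_hd R L.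
rewrite -[LHS]/(g y) -[RHS]/(h y); apply: RL_ext => {}y.
  rewrite -[LHS]/(ext_hd R L (act_fun _)) -[RHS]/(cbc Om (ahomF act) (ext_hd R L _)).
  rewrite act_inl spec_theta thT_inr ext_hd_inl.
  rewrite (cbc_comp (w := ahom_comp spec (ahom_inr R R))) //.
  by symmetry; apply: cbc_comp => r; symmetry; apply: act_inl.
rewrite -[LHS]/(ext_hd R L (act_fun _)) -[RHS]/(cbc Om (ahomF act) (ext_hd R L _)).
by rewrite act_inr ext_hd_inr cbc_cin; congr cin; symmetry; apply: act_inr.
Qed.

End Point.

(* On T, act p o spec (p o antipode) and spec p o swap agree. *)
Lemma act_antipode L (p q : ahom U L) : (forall u, q u = p (antipode u)) ->
  cancel (act q) (act p).
Proof.
move=> qp x; pose f : {rmorphism RL R L -> RL R L} := act p \o act q.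
rewrite -[LHS]/(f x) -[RHS]/((idfun : {rmorphism RL R L -> RL R L}) x).
apply: RL_ext => y; rewrite -[LHS]/(act_fun p (act_fun q _)); last by rewrite !act_inr.
rewrite act_inl /=.
pose g : {rmorphism T -> RL R L} := act_fun p \o spec q.
pose h : {rmorphism T -> RL R L} := spec p \o swap.
transitivity (h (inr y)).
  rewrite -[LHS]/(g (inr y)); apply: T_ext => z.
    rewrite -[LHS]/(act_fun p (spec q _)) -[RHS]/(spec p (swap_fun _)).
    by rewrite spec_inl act_inl swap_inl.
  rewrite -[LHS]/(act_fun p (spec q _)) -[RHS]/(spec p (swap _)).
  by rewrite spec_cinc act_inr -antipodeE spec_cinc qp.
by rewrite -[LHS]/(spec p (swap_fun _)) swap_inr spec_inl.
Qed.

(** The antipode is an involution because the exchange is, so [act_antipode] applies in both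
    orders. *)
Lemma act_bij L (p : ahom U L) : bijective (act p).
Proof.
exists (act (ahom_comp p antipode)); apply: act_antipode => // u /=.
by congr (p _); apply: cinc_inj; rewrite !antipodeE swapK.
Qed.

(** * The bijection between points of [U] and automorphisms, and its naturality *)

Definition autpt L (p : ahom U L) : thaut R L := ThAut (act_bij p) (act_comm p).

(** The automorphism determines [spec p] on 1 (x) R, hence on all of [T]; on [U] the latter is 1 (x)
    p, and L -> R_L is injective. *)
Lemma autpt_inj L : injective (@autpt L).
Proof.
move=> p q pq; apply: ahom_eq => u; apply: (tinrRL_inj R_simple).
rewrite -!spec_cinc.
suff : (spec p : {rmorphism T -> RL R L}) =1 (spec q : {rmorphism T -> RL R L}) by apply.
apply: tens_rext => r; first by rewrite [LHS]spec_inl [RHS]spec_inl.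
rewrite -[LHS](act_inl p) -[RHS](act_inl q).
by rewrite -[LHS]/(autpt p _) pq.
Qed.

(* r (x) r' |-> r f(r') is a theta-morphism T -> R_L, so it maps U to the
   constants L of R_L. *)
Lemma autpt_surj L (f : thaut R L) : exists p, autpt p = f.
Proof.
pose u : {rmorphism R -> RL R L} := @tinl _ (RK R) L : {rmorphism RK R -> tens (RK R) L}.
pose v : {rmorphism R -> RL R L} := ta_fun f \o u.
have uv s : u (calg_in R s) = v (calg_in R s).
  by rewrite -[RHS]/(f (@tinl _ (RK R) L (calg_in R s))) RL_inl ahomP -RL_inl.
pose g : {rmorphism T -> RL R L} := tpush uv.
have g_inl r : g (inl r) = @tinl _ (RK R) L r by exact: (tpush_inl uv).
have g_inr r : g (inr r) = f (@tinl _ (RK R) L r) by exact: (tpush_inr uv).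
have gP s : g (calg_in T s) = calg_in (RLF R L) s.
  by rewrite [LHS]g_inl RL_inl.
pose gF : ahom T (RLF R L) := @AHom F T (RLF R L) g gP.
have g_theta t : ext_hd R L (g t) = cbc Om gF (thT t).
  pose g1 : {rmorphism T -> cpl (bc (RLF R L) Om)} := ext_hd R L \o g.
  pose g2 : {rmorphism T -> cpl (bc (RLF R L) Om)} := cbc Om gF \o thT.
  rewrite -[LHS]/(g1 t) -[RHS]/(g2 t); apply: tens_rext => r.
    rewrite -[LHS]/(ext_hd R L (g (inl r))) -[RHS]/(cbc Om gF (thT (inl r))).
    rewrite g_inl ext_hd_inl thT_inl; symmetry; apply: cbc_comp => s.
    by symmetry; apply: g_inl.
  rewrite -[LHS]/(ext_hd R L (g (inr r))) -[RHS]/(cbc Om gF (thT (inr r))).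
  rewrite g_inr (ta_comm f) ext_hd_inl thT_inr.
  rewrite (cbc_comp (w := ahom_comp (ahomF f) (inRL R L))) //.
  by symmetry; apply: cbc_comp => s; symmetry; apply: g_inr.
have gU (w : U) : exists a, g (cinc w) = @tinr _ (RK R) L a.
  apply: (ext_cst R_simple R_const) => k l k0; apply: hdcoef_cst k0 _.
  by rewrite g_theta cstP cbc_cin.
have [p pP] := choice gU.
(* So far [p] is chosen pointwise; injectivity of L -> R_L makes it a morphism of K-algebras. *)
have p_zmod : zmod_morphism p.
  by move=> x y; apply: (tinrRL_inj R_simple); rewrite [RHS]rmorphB /= -!pP !rmorphB.
have p_monoid : monoid_morphism p.
  split=> [|x y]; apply: (tinrRL_inj R_simple); first by rewrite -pP !rmorph1.
  by rewrite [RHS]rmorphM /= -!pP !rmorphM.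
pose pM : {rmorphism U -> L} := HB.pack p
  (GRing.isZmodMorphism.Build U L p p_zmod) (GRing.isMonoidMorphism.Build U L p p_monoid).
have pK c : pM (calg_in U c) = calg_in L c.
  apply: (tinrRL_inj R_simple); rewrite -[LHS]pP.
  rewrite -[cinc _]/(inl (calg_in (RK R) c)) g_inl.
  exact: (@tin_bal K (RK R) L).
exists (@AHom K U L pM pK); apply: thaut_eq => x.
set q := @AHom K U L pM pK.
rewrite -[LHS]/((act_fun q : {rmorphism RL R L -> RL R L}) x).
rewrite -[RHS]/((ta_fun f : {rmorphism RL R L -> RL R L}) x).
apply: RL_ext => y; last by rewrite act_inr [in RHS]RL_inr ahomP -RL_inr.
(* [spec q] and [g] agree on R (x) 1 and on [U], hence also on 1 (x) R, which carries the
   automorphisms. *)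
rewrite act_inl -g_inr; apply: (@T_ext _ (spec q) g) => z.
  by rewrite g_inl [LHS]spec_inl.
by rewrite [LHS]spec_cinc pP.
Qed.

(** Both automorphisms come from morphisms T -> R_L' that agree on R (x) 1 and on [U]. *)
Lemma autpt_nat L L' (f : ahom L L') (p : ahom U L) :
  autpt (ahom_comp f p) = bch f (autpt p).
Proof.
apply: thaut_eq => x.
rewrite -[LHS]/(act_fun (ahom_comp f p) x) -[RHS]/(bch_fun f (autpt p) x).
apply: RL_ext => y; last by rewrite act_inr bch_inr.
rewrite act_inl bch_inl -[autpt p _]/(act_fun p _) act_inl.
pose g : {rmorphism T -> RL R L'} := RL_map R f \o spec p.
rewrite -[RHS]/(g _); apply: (@T_ext _ (spec (ahom_comp f p)) g) => z.
  by rewrite -[RHS]/(RL_map R f (spec p _)) [LHS]spec_inl spec_inl RL_map_inl.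
by rewrite -[RHS]/(RL_map R f (spec p _)) [LHS]spec_cinc spec_cinc RL_map_inr.
Qed.

Lemma Aut_theta_represented : represents U (Aut_theta R).
Proof.
exists autpt; split=> [L|L L' f p]; last exact: autpt_nat.
have [g gP] := choice (@autpt_surj L).
by exists g => // p; apply: autpt_inj; rewrite gP.
Qed.

End Representation.

Theorem proposition10p9 (K F : fieldType) (iK : {rmorphism K -> F})
    (Om : galg F) (Om_domain : forall x y : cpl Om, x * y = 0 -> x = 0 \/ y = 0)
    (theta : hder iK Om) (theta_iter : iterable theta)
    (theta_const : const_base theta)
    (R : thring theta) (R_PPV : PPV R) :
  fin_gen (const_alg (hder_tens R R)) /\
  represents (const_alg (hder_tens R R)) (Aut_theta R).
Proof.
have [n [A [[Agl _ _] Rppv]]] := R_PPV.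
have [gens gensP] := PPV_cst_span Agl Rppv.
have [R_simple _ R_const] := Rppv.
split; first exact: cst_fin_gen gensP.
exact: Aut_theta_represented gensP.
Qed.
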